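(* Let $K$ be a transition matrix on $\mathcal X=\{0,1,\dots,N\}$ generated by one of the convolutions listed in the context from measures of one family (Krawtchouk, Hahn or $q$-Hahn), and suppose that for some admissible parameter $\lambda$ of the same family $K(x,y)\,\pi(y,N,\lambda)=K(y,x)\,\pi(x,N,\lambda)$ for all $x,y\in\mathcal X$. Let $\kappa(n)$ be the eigenvalue of $K$ belonging to the eigenvector $\pi(x,N,\lambda)\check P_n(x,\lambda)$, and let $\hat\phi_0(x)=\sqrt{\pi(x,N,\lambda)}$, $\hat\phi_n(x)=d_n\hat\phi_0(x)\check P_n(x,\lambda)$. (a) Let $\mathcal P(x;0)\ge0$ with $\sum_{x\in\mathcal X}\mathcal P(x;0)=1$, and let $\mathcal P(x;\ell+1)=\sum_{y\in\mathcal X}K(x,y)\mathcal P(y;\ell)$ for $\ell\ge0$. Then the distribution after $\ell$ steps is $$\mathcal P(x;\ell)=\hat\phi_0(x)\sum_{n\in\mathcal X}c_n\,\kappa(n)^{\ell}\,\hat\phi_n(x)=\pi(x,N,\lambda)\sum_{n\in\mathcal X}c_nd_n\,\kappa(n)^{\ell}\,\check P_n(x,\lambda),$$ where the $c_n$ are determined by the expansion $\mathcal P(x;0)=\hat\phi_0(x)\sum_{n\in\mathcal X}c_n\hat\phi_n(x)$, i.e. $$c_n=\sum_{x\in\mathcal X}\hat\phi_n(x)\hat\phi_0(x)^{-1}\mathcal P(x;0)=d_n\sum_{x\in\mathcal X}\check P_n(x,\lambda)\,\mathcal P(x;0)\quad(n\in\mathcal X),\qquad c_0=1.$$ (b) The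 $\ell$-step transition matrix from $y$ to $x$ is $$\mathcal P(x,y;\ell)=K^{\ell}(x,y)=\hat\phi_0(x)\sum_{n\in\mathcal X}\kappa(n)^{\ell}\hat\phi_n(x)\hat\phi_n(y)\hat\phi_0(y)^{-1}=\pi(x,N,\lambda)\sum_{n\in\mathcal X}d_n^2\,\kappa(n)^{\ell}\,\check P_n(x,\lambda)\check P_n(y,\lambda).$$ (c) $\kappa(0)=1$ and $-1<\kappa(n)<1$ for $n\ne0$, and the stationary distribution is reached asymptotically: for all $x,y\in\mathcal X$, $$\lim_{\ell\to\infty}\mathcal P(x;\ell)=\lim_{\ell\to\infty}\mathcal P(x,y;\ell)=\pi(x,N,\lambda).$$
   Context: Notation: $N\ge1$ integer, $(a)_n=a(a+1)\cdots(a+n-1)$, $(a;q)_n=\prod_{i=0}^{n-1}(1-aq^i)$, $0<q<1$ fixed. Measures $\pi(x,M,\lambda)$ for integers $0\le x\le M$ (zero for other integer arguments), and polynomials $\check P_n(x,\lambda)$, $n,x\in\mathcal X$ (normalised by $\check P_0(x)=1$, $\check P_n(0)=1$): - Krawtchouk, $\lambda=p$, $0<p<1$: $\pi(x,M,p)=\binom{M}{x}p^x(1-p)^{M-x}$; $\check P_n(x,p)=\sum_{k=0}^n\frac{(-n)_k(-x)_k}{(-N)_k\,k!}p^{-k}$. - Hahn, $\lambda=(a,b)$, $a,b>0$: $\pi(x,M,a,b)=\binom{M}{x}\frac{(a)_x(b)_{M-x}}{(a+b)_M}$; $\check P_n(x,a,b)=\sum_{k=0}^n\frac{(-n)_k(n+a+b-1)_k(-x)_k}{(a)_k(-N)_k\,k!}$.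 - $q$-Hahn, $\lambda=(a,b)$, $0<a<1$, $b<1$: $\pi(x,M,a,b)=\frac{(q;q)_M}{(q;q)_x(q;q)_{M-x}}\frac{(a;q)_x(b;q)_{M-x}a^{M-x}}{(ab;q)_M}$; $\check P_n(x,a,b)=\sum_{k=0}^n\frac{(q^{-n};q)_k(abq^{n-1};q)_k(q^{-x};q)_k}{(a;q)_k(q^{-N};q)_k(q;q)_k}q^k$. The constants $d_n>0$ are defined by $\sum_{x\in\mathcal X}\pi(x,N,\lambda)\check P_m(x,\lambda)\check P_n(x,\lambda)=\delta_{m,n}/d_n^2$ (so $d_0=1$). In this setting each $\pi(x,N,\lambda)\check P_n(x,\lambda)$ is a right eigenvector of $K$: $\sum_{y}K(x,y)\pi(y,N,\lambda)\check P_n(y,\lambda)=\kappa(n)\pi(x,N,\lambda)\check P_n(x,\lambda)$, which defines $\kappa(n)$. Convolutions ($x,y\in\mathcal X$; $\lambda_1,\lambda_2,\lambda_3$ admissible parameters of the family; (i)–(v) allowed for Krawtchouk and Hahn, (i), (iii), (iv) for $q$-Hahn): (i) $K(x,y)=\sum_{z=0}^{\min(x,y)}\pi(x-z,N-z,\lambda_2)\,\pi(z,y,\lambda_1)$; (ii) $K(x,y)=\sum_{z=\max(0,x+y-N)}^{\min(x,y)}\pi(x-z,N-y,\lambda_2)\,\pi(z,y,\lambda_1)$; (iii) $K(x,y)=\sum_{z=\max(x,y)}^{N}\pi(x,z,\lambda_2)\,\pi(z-y,N-y,\lambda_1)$; (iv) $K(x,y)=\sum_{z_2=0}^{\min(x,y)}\pi(z_2,y,\lambda_1)\sum_{z_1=\max(x,y)}^{N}\pi(x-z_2,z_1-z_2,\lambda_3)\,\pi(z_1-y,N-y,\lambda_2)$;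 (v) $K(x,y)=\sum_{z_2=0}^{\min(x,y)}\pi(z_2,y,\lambda_1)\sum_{z_1=x+y-z_2}^{N}\pi(x-z_2,z_1-y,\lambda_3)\,\pi(z_1-y,N-y,\lambda_2)$. *)

(* Defs.v *)
From HB Require Import structures.
From mathcomp Require Import all_boot all_order all_algebra.
From mathcomp Require Import all_classical all_reals all_analysis.

Set Implicit Arguments.
Unset Strict Implicit.
Unset Printing Implicit Defensive.

Import Order.TTheory GRing.Theory Num.Theory.
Import numFieldNormedType.Exports.

Local Open Scope ring_scope.

Definition poch (R : realType) (a : R) (n : nat) : R :=
  \prod_(i < n) (a + i%:R).

Definition qpoch (R : realType) (q a : R) (n : nat) : R :=
  \prod_(i < n) (1 - a * q ^+ i).

Inductive op_family := Krawtchouk | Hahn | QHahn.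

Definition op_param (R : realType) (F : op_family) : Type :=
  match F with Krawtchouk => R | Hahn | QHahn => (R * R)%type end.

Definition admissible (R : realType) (F : op_family) : op_param R F -> Prop :=
  match F return op_param R F -> Prop with
  | Krawtchouk => fun p => 0 < p < 1
  | Hahn => fun l => (0 < l.1) && (0 < l.2)
  | QHahn => fun l => (0 < l.1 < 1) && (l.2 < 1)
  end.

(* The formulas for the measures are only meaningful for x <= M (the natural
   subtraction M - x is truncated); [op_meas] extends them by zero. *)
Definition krawtchouk_meas (R : realType) (x M : nat) (p : R) : R :=
  'C(M, x)%:R * p ^+ x * (1 - p) ^+ (M - x).

Definition hahn_meas (R : realType) (x M : nat) (a b : R) : R :=
  'C(M, x)%:R * (poch a x * poch b (M - x) / poch (a + b) M).

Definition qhahn_meas (R : realType) (q : R) (x M : nat) (a b : R) : R :=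
  qpoch q q M / (qpoch q q x * qpoch q q (M - x))
  * (qpoch q a x * qpoch q b (M - x) * a ^+ (M - x) / qpoch q (a * b) M).

Definition op_meas (R : realType) (q : R) (F : op_family) (x M : nat) :
    op_param R F -> R :=
  match F return op_param R F -> R with
  | Krawtchouk => fun p => if (x <= M)%N then krawtchouk_meas x M p else 0
  | Hahn => fun l => if (x <= M)%N then hahn_meas x M l.1 l.2 else 0
  | QHahn => fun l => if (x <= M)%N then qhahn_meas q x M l.1 l.2 else 0
  end.

Definition krawtchouk_poly (R : realType) (N n x : nat) (p : R) : R :=
  \sum_(k < n.+1)
    poch (- n%:R) k * poch (- x%:R) k / (poch (- N%:R) k * k`!%:R) * p ^- k.

Definition hahn_poly (R : realType) (N n x : nat) (a b : R) : R :=
  \sum_(k < n.+1)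
    poch (- n%:R) k * poch (n%:R + a + b - 1) k * poch (- x%:R) k
    / (poch a k * poch (- N%:R) k * k`!%:R).

(* q ^- n is the inverse of q ^+ n, and q ^+ n / q is q to the n - 1,
   also for n = 0. *)
Definition qhahn_poly (R : realType) (q : R) (N n x : nat) (a b : R) : R :=
  \sum_(k < n.+1)
    qpoch q (q ^- n) k * qpoch q (a * b * (q ^+ n / q)) k * qpoch q (q ^- x) k
    / (qpoch q a k * qpoch q (q ^- N) k * qpoch q q k) * q ^+ k.

Definition Pcheck (R : realType) (q : R) (F : op_family) (N n x : nat) :
    op_param R F -> R :=
  match F return op_param R F -> R with
  | Krawtchouk => fun p => krawtchouk_poly N n x p
  | Hahn => fun l => hahn_poly N n x l.1 l.2
  | QHahn => fun l => qhahn_poly q N n x l.1 l.2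
  end.

Inductive convolution := ConvI | ConvII | ConvIII | ConvIV | ConvV.

Definition allowed (F : op_family) (C : convolution) : bool :=
  match F, C with
  | QHahn, (ConvII | ConvV) => false
  | _, _ => true
  end.

(* On each summation range below every natural subtraction occurring in the
   summand is exact; in ConvII the lower bound x + y - N is truncated at 0 on
   purpose.  The parameter l3 is only used by ConvIV and ConvV. *)
Definition conv_entry (R : realType) (q : R) (F : op_family) (C : convolution) (N : nat)
    (l1 l2 l3 : op_param R F) (x y : nat) : R :=
  match C with
  | ConvI =>
      \sum_(0 <= z < (minn x y).+1)
        op_meas q (x - z) (N - z) l2 * op_meas q z y l1
  | ConvII =>
      \sum_(x + y - N <= z < (minn x y).+1)
        op_meas q (x - z) (N - y) l2 * op_meas q z y l1
  | ConvIII =>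
      \sum_(maxn x y <= z < N.+1)
        op_meas q x z l2 * op_meas q (z - y) (N - y) l1
  | ConvIV =>
      \sum_(0 <= z2 < (minn x y).+1)
        op_meas q z2 y l1 *
        \sum_(maxn x y <= z1 < N.+1)
          op_meas q (x - z2) (z1 - z2) l3 * op_meas q (z1 - y) (N - y) l2
  | ConvV =>
      \sum_(0 <= z2 < (minn x y).+1)
        op_meas q z2 y l1 *
        \sum_(x + y - z2 <= z1 < N.+1)
          op_meas q (x - z2) (z1 - y) l3 * op_meas q (z1 - y) (N - y) l2
  end.

(* K x y is the probability of moving from y to x: columns sum to 1. *)
Definition conv_mx (R : realType) (q : R) (F : op_family) (C : convolution)
    (N : nat) (l1 l2 l3 : op_param R F) : 'M[R]_N.+1 :=
  \matrix_(x, y) conv_entry q C N l1 l2 l3 x y.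

Definition norm_consts (R : realType) (q : R) (F : op_family) (N : nat)
    (lam : op_param R F) (d : 'I_N.+1 -> R) : Prop :=
  (forall n, 0 < d n) /\
  (forall m n : 'I_N.+1,
     \sum_(x < N.+1) op_meas q x N lam * Pcheck q N m x lam * Pcheck q N n x lam
     = (m == n)%:R / d n ^+ 2).

Definition conv_eigenvalues (R : realType) (q : R) (F : op_family) (N : nat)
    (lam : op_param R F) (K : 'M[R]_N.+1) (kappa : 'I_N.+1 -> R) : Prop :=
  forall n x : 'I_N.+1,
    \sum_(y < N.+1) K x y * (op_meas q y N lam * Pcheck q N n y lam)
    = kappa n * (op_meas q x N lam * Pcheck q N n x lam).

Definition phihat0 (R : realType) (q : R) (F : op_family) (N : nat)
    (lam : op_param R F) (x : 'I_N.+1) : R :=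
  Num.sqrt (op_meas q x N lam).

(* For n = 0 this agrees with [phihat0], since d 0 = 1 for norm_consts d. *)
Definition phihat (R : realType) (q : R) (F : op_family) (N : nat)
    (lam : op_param R F) (d : 'I_N.+1 -> R) (n x : 'I_N.+1) : R :=
  d n * phihat0 q lam x * Pcheck q N n x lam.

Definition chain_distribution (R : realType) (N : nat) (K : 'M[R]_N.+1)
    (P : nat -> 'I_N.+1 -> R) : Prop :=
  [/\ forall x, 0 <= P 0%N x,
      \sum_(x < N.+1) P 0%N x = 1
    & forall l x, P l.+1 x = \sum_(y < N.+1) K x y * P l y].

(* Main.v *)
(* Write eta x for x (Krawtchouk, Hahn) or q^(-x) (q-Hahn).  The shifted
   factorials (-x)_k, resp. (q^(-x);q)_k, are polynomials in eta x whose mean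
   under pi(., M, l) is a constant times their value at M.  Hence averaging over
   a point chosen between two given points maps polynomials of degree m in the
   eta's to polynomials of degree at most m, and since every convolution is an
   iterated average of this kind, so does the transpose of K.  As it is also
   self-adjoint for the weight pi(., N, lam), whose orthogonal polynomials are
   the P_n, it multiplies each P_n by a scalar kappa(n).  Orthogonality of the
   P_n reduces to the vanishing of n-th (q-)differences of polynomials of degree
   less than n.  All entries of K are positive, so |kappa(n)| < 1 for n <> 0 by a
   maximum principle. *)
Require Import Defs.
From HB Require Import structures.
From mathcomp Require Import all_boot all_order all_algebra.
From mathcomp Require Import all_classical all_reals all_analysis.
From mathcomp Require Import ring lra zify.

Set Implicit Arguments.
Unset Strict Implicit.
Unset Printing Implicit Defensive.

Import Order.TTheory GRing.Theory Num.Theory.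
Import numFieldNormedType.Exports.

Local Open Scope classical_set_scope.
Local Open Scope ring_scope.

(** * Shifted factorials and q-shifted factorials *)

Section Pochhammer.
Variable R : realType.
Implicit Types a q : R.

Lemma poch0 a : poch a 0 = 1.
Proof. by rewrite /poch big_ord0. Qed.

Lemma pochS a k : poch a k.+1 = a * poch (a + 1) k.
Proof.
rewrite /poch big_ord_recl /= addr0; congr (_ * _); apply: eq_bigr => i _.
by rewrite /bump /= add1n -natr1 (addrC i%:R) addrA.
Qed.

Lemma pochSr a k : poch a k.+1 = poch a k * (a + k%:R).
Proof. by rewrite /poch big_ord_recr. Qed.

Lemma poch_add a i j : poch a (i + j) = poch a i * poch (a + i%:R) j.
Proof.
elim: j => [|j IH]; first by rewrite addn0 poch0 mulr1.
by rewrite addnS !pochSr IH natrD -mulrA addrA.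
Qed.

Lemma poch_gt0 a k : 0 < a -> 0 < poch a k.
Proof. by move=> a0; apply: prodr_gt0 => i _; rewrite ltr_wpDr. Qed.

Lemma poch_opp_nat_neq0 (M k : nat) : (k <= M)%N -> poch (- M%:R) k != 0 :> R.
Proof.
move=> kM; rewrite prodf_seq_neq0; apply/allP => i _ /=.
rewrite addrC subr_eq0 eqr_nat ltn_eqF //.
exact: leq_trans (ltn_ord i) kM.
Qed.

Lemma qpoch0 q a : qpoch q a 0 = 1.
Proof. by rewrite /qpoch big_ord0. Qed.

Lemma qpochS q a k : qpoch q a k.+1 = (1 - a) * qpoch q (a * q) k.
Proof.
rewrite /qpoch big_ord_recl /= expr0 mulr1; congr (_ * _).
by apply: eq_bigr => i _; rewrite /bump /= add1n exprS mulrA.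
Qed.

Lemma qpochSr q a k : qpoch q a k.+1 = qpoch q a k * (1 - a * q ^+ k).
Proof. by rewrite /qpoch big_ord_recr. Qed.

Lemma qpoch_add q a i j :
  qpoch q a (i + j) = qpoch q a i * qpoch q (a * q ^+ i) j.
Proof.
elim: j => [|j IH]; first by rewrite addn0 qpoch0 mulr1.
by rewrite addnS !qpochSr IH exprD -!mulrA.
Qed.

Lemma qpoch_gt0 q a k : 0 < q < 1 -> a < 1 -> 0 < qpoch q a k.
Proof.
move=> /andP[q0 q1] a1; apply: prodr_gt0 => i _; rewrite subr_gt0.
have qi0 : 0 < q ^+ i by rewrite exprn_gt0.
have qi1 : q ^+ i <= 1 by rewrite exprn_ile1 // ltW.
have [a0|a0] := ltP a 0; first by rewrite (@lt_le_trans _ _ 0) // nmulr_rlt0.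
by rewrite (le_lt_trans _ a1) // ler_piMr.
Qed.

Lemma qpoch_opp_neq0 q (M k : nat) :
  0 < q < 1 -> (k <= M)%N -> qpoch q (q ^- M) k != 0.
Proof.
move=> /andP[q0 q1] kM; rewrite prodf_seq_neq0; apply/allP => i _ /=.
have iM : (i < M)%N := leq_trans (ltn_ord i) kM.
have qM : q ^+ M != 0 by rewrite expf_neq0 // gt_eqF.
rewrite subr_eq0 eq_sym -(inj_eq (mulfI qM)) mulrA mulfV // mul1r mulr1.
rewrite gt_eqF //; first by rewrite ltr_iXn2l.
Qed.

End Pochhammer.

(** * Total mass and factorial moments of the three families of measures *)

Section Families.
Variables (R : realType) (q : R) (q01 : 0 < q < 1).

Let q_gt0 : 0 < q. Proof. by case/andP: q01. Qed.
Let q_neq0 : q != 0. Proof. by rewrite gt_eqF. Qed.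
Let qX_neq0 n : q ^+ n != 0. Proof. by rewrite expf_neq0. Qed.

Definition eta (F : op_family) (x : nat) : R :=
  if F is QHahn then q ^- x else x%:R.

Definition ffac_scale (F : op_family) (i : nat) : R :=
  if F is QHahn then q ^+ i else 1.

Definition ffac_shift (F : op_family) (i : nat) : R :=
  if F is QHahn then 0 else i%:R.

(* [ffac F k 0 x] is (-x)_k, resp. (q^(-x);q)_k; [ffac F k z x] is the same
   at x - z, multiplied by q^(-k z) in the q-case so that it is a polynomial in
   [eta z] and [eta x]. *)
Definition ffac (F : op_family) (k z x : nat) : R :=
  \prod_(i < k) (eta F z - ffac_scale F i * eta F x + ffac_shift F i).

(** Parameter of the size-biased measure: weighting by [eta F 0 - eta F x] and moving [x] down by
    one gives, up to a constant, the measure of size one less with this parameter. *)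
Definition up_param (F : op_family) : op_param R F -> op_param R F :=
  match F with
  | Krawtchouk => fun p => p
  | Hahn => fun l => (l.1 + 1, l.2)
  | QHahn => fun l => (l.1 * q, l.2)
  end.

(** Counterpart of [up_param] for the weight [cofac], under which [x] stays fixed while the size
    drops. *)
Definition down_param (F : op_family) : op_param R F -> op_param R F :=
  match F with
  | Krawtchouk => fun p => p
  | Hahn => fun l => (l.1, l.2 + 1)
  | QHahn => fun l => (l.1, l.2 * q)
  end.

Definition mom1 (F : op_family) : op_param R F -> R :=
  match F with
  | Krawtchouk => fun p => p
  | Hahn => fun l => l.1 / (l.1 + l.2)
  | QHahn => fun l => (1 - l.1) / (1 - l.1 * l.2)
  end.

(** In closed form p^k, (a)_k/(a+b)_k or (a;q)_k/(ab;q)_k. The recursion follows the induction of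
    [ffac_moment0], where each step raises the parameter. *)
Fixpoint mom (F : op_family) (k : nat) (l : op_param R F) : R :=
  if k is k'.+1 then mom1 l * mom k' (up_param l) else 1.

Definition bracket (F : op_family) (n : nat) : R :=
  if F is QHahn then 1 - q ^+ n else n%:R.

(* [cofac F N x] is N - x, resp. 1 - q^(N - x), as an affine function of
   [eta x]. *)
Definition cofac (F : op_family) (N x : nat) : R :=
  bracket F N + (if F is QHahn then q ^+ N else 1) * (eta F 0 - eta F x).

(** For [j <= N], (N-x)(N-1-x)...(N-j+1-x) or its q-analogue. Used in place of powers of [eta F x]:
    such a factor only changes the size and parameter of the weight, so factors [ffac F k 0 x] can
    still be averaged. *)
Definition cofacs (F : op_family) (j N x : nat) : R :=
  \prod_(i < j) cofac F (N - i) x.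

Lemma prodlt1 (a b : R) : 0 < a < 1 -> b < 1 -> a * b < 1.
Proof.
move=> /andP[a0 a1] b1; have [b0|b0] := ltP b 0.
  by rewrite (@lt_trans _ _ 0) // pmulr_rlt0.
by rewrite (le_lt_trans _ b1) // ler_piMl // ltW.
Qed.

Lemma admissible_up (F : op_family) (l : op_param R F) :
  admissible l -> admissible (up_param l).
Proof.
case/andP: q01 => q0 q1; case: F l => //= l.
  by case/andP=> a b; rewrite addr_gt0.
case/andP=> /andP[a0 a1] b; rewrite b mulr_gt0 //=.
by rewrite (lt_trans _ a1) // gtr_pMr.
Qed.

Lemma admissible_down (F : op_family) (l : op_param R F) :
  admissible l -> admissible (down_param l).
Proof.
case/andP: q01 => q0 q1; case: F l => //= l.
  by case/andP=> a b; rewrite addr_gt0 // a.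
by case/andP=> -> b; rewrite /= mulrC prodlt1.
Qed.

Lemma op_meas_gt0 (F : op_family) (l : op_param R F) (x M : nat) :
  admissible l -> (x <= M)%N -> 0 < op_meas q x M l.
Proof.
case: F l => /= l; rewrite /krawtchouk_meas /hahn_meas /qhahn_meas.
- case/andP=> p0 p1 xM; rewrite xM.
  by rewrite !mulr_gt0 ?exprn_gt0 ?subr_gt0 ?ltr0n ?bin_gt0.
- case/andP=> a0 b0 xM; rewrite xM.
  rewrite mulr_gt0 ?ltr0n ?bin_gt0 // divr_gt0 ?mulr_gt0 ?poch_gt0 //.
  by rewrite addr_gt0.
- case/andP=> /andP[a0 a1] b1 xM; rewrite xM.
  have q1 : q < 1 by case/andP: q01.
  rewrite mulr_gt0 // divr_gt0 ?mulr_gt0 ?qpoch_gt0 ?exprn_gt0 //.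
  by rewrite prodlt1 // a0.
Qed.

Lemma op_meas_out (F : op_family) (l : op_param R F) (x M : nat) :
  (M < x)%N -> op_meas q x M l = 0.
Proof. by move=> Mx; case: F l => /= l; rewrite leqNgt Mx. Qed.

Lemma cofac_diag (F : op_family) (N : nat) : cofac F N N = 0.
Proof.
rewrite /cofac; case: F => /=; rewrite ?mul1r ?sub0r ?subrr //.
by rewrite expr0 invr1 mulrBr mulr1 mulfV // addrC subrKA subrr.
Qed.

(** The factor is absorbed by the (q-)binomial coefficient, and the first factors of the shifted
    factorials of a and a+b (resp. ab) split off as [mom1 l]. *)
Lemma op_meas_up (F : op_family) (l : op_param R F) (x M : nat) :
  admissible l -> (x <= M)%N ->
  op_meas q x.+1 M.+1 l * (eta F 0 - eta F x.+1) =
  mom1 l * (eta F 0 - eta F M.+1) * op_meas q x M (up_param l).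
Proof.
have binS : (x.+1%:R * 'C(M.+1, x.+1)%:R = M.+1%:R * 'C(M, x)%:R :> R).
  by rewrite -!natrM -mul_bin_diag.
case: F l => /= l; rewrite /krawtchouk_meas /hahn_meas /qhahn_meas.
- move=> _ xM; rewrite ltnS xM subSS exprS !sub0r.
  transitivity (- (x.+1%:R * 'C(M.+1, x.+1)%:R) * l * l ^+ x * (1 - l) ^+ (M - x)).
    by ring.
  by rewrite binS; ring.
- case/andP=> a0 b0 xM; rewrite ltnS xM subSS !pochS !sub0r.
  have ab0 : l.1 + l.2 != 0 by rewrite gt_eqF // addr_gt0.
  have -> : l.1 + 1 + l.2 = l.1 + l.2 + 1 by ring.
  have pab : poch (l.1 + l.2 + 1) M != 0 by rewrite gt_eqF // poch_gt0 // !addr_gt0.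
  transitivity (- (x.+1%:R * 'C(M.+1, x.+1)%:R) * l.1 / (l.1 + l.2) *
     (poch (l.1 + 1) x * poch l.2 (M - x) / poch (l.1 + l.2 + 1) M)).
    by field; rewrite ?pab ?ab0.
  by rewrite binS; field; rewrite ?pab ?ab0.
- case/andP=> a01 b1 xM; rewrite ltnS xM subSS !(qpochS _ l.1) (qpochS _ (l.1 * l.2)).
  rewrite !(qpochSr q q) -!exprS expr0 invr1.
  have q1 : q < 1 by case/andP: q01.
  have ab0 : 1 - l.1 * l.2 != 0 by rewrite gt_eqF // subr_gt0 prodlt1.
  have -> : l.1 * q * l.2 = l.1 * l.2 * q by ring.
  have pab : qpoch q (l.1 * l.2 * q) M != 0.
    rewrite gt_eqF // qpoch_gt0 //.
    by rewrite mulrC prodlt1 // ?q01 // prodlt1.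
  have pq k : qpoch q q k != 0 by rewrite gt_eqF // qpoch_gt0.
  have q1n k : 1 - q ^+ k.+1 != 0 by rewrite gt_eqF // subr_gt0 exprn_ilt1 // ltW.
  rewrite exprMn.
  (* All powers of [q] are expressed through two independent ones, which leaves a rational
     identity. *)
  have qMx : q ^+ M.+1 = q ^+ x.+1 * q ^+ (M - x) by rewrite -exprD; congr (_ ^+ _); lia.
  have := q1n M; rewrite qMx => q1M.
  have := q1n x; set u := q ^+ x.+1; set v := q ^+ (M - x) => q1x.
  have u0 : u != 0 by exact: qX_neq0.
  have v0 : v != 0 by exact: qX_neq0.
  field.
  by rewrite ?pab ?u0 v0 q1x !pq ab0.
Qed.

Lemma op_meas_down (F : op_family) (l : op_param R F) (x M : nat) :
  admissible l -> (x <= M)%N ->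
  op_meas q x M.+1 l * cofac F M.+1 x =
  bracket F M.+1 * (1 - mom1 l) * op_meas q x M (down_param l).
Proof.
have binD : (x <= M)%N ->
  ((M.+1%:R - x%:R) * 'C(M.+1, x)%:R = M.+1%:R * 'C(M, x)%:R :> R).
  move=> xM; rewrite -natrB ?(leqW xM) // -!natrM.
  by rewrite mul_bin_down.
rewrite /cofac; case: F l => /= l; rewrite /krawtchouk_meas /hahn_meas /qhahn_meas.
- move=> _ xM; rewrite (leqW xM) xM subSn // exprS.
  rewrite mul1r sub0r.
  transitivity ((M.+1%:R - x%:R) * 'C(M.+1, x)%:R * l ^+ x * (1 - l) ^+ (M - x) * (1 - l)).
    by ring.
  by rewrite binD //; ring.
- case/andP=> a0 b0 xM; rewrite (leqW xM) xM subSn // !(pochS l.2) (pochS (_ + _)) mul1r sub0r.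
  have ab0 : l.1 + l.2 != 0 by rewrite gt_eqF // addr_gt0.
  have -> : l.1 + (l.2 + 1) = l.1 + l.2 + 1 by ring.
  have pab : poch (l.1 + l.2 + 1) M != 0 by rewrite gt_eqF // poch_gt0 // !addr_gt0.
  transitivity ((M.+1%:R - x%:R) * 'C(M.+1, x)%:R * l.2 / (l.1 + l.2) *
     (poch l.1 x * poch (l.2 + 1) (M - x) / poch (l.1 + l.2 + 1) M)).
    by field; rewrite ?pab ?ab0.
  by rewrite binD //; field; rewrite ?pab ?ab0.
- case/andP=> a01 b1 xM; rewrite (leqW xM) xM subSn // !(qpochS _ l.2) (qpochS _ (l.1 * l.2)).
  rewrite !(qpochSr q q) -!exprS expr0 invr1.
  have q1 : q < 1 by case/andP: q01.
  have ab0 : 1 - l.1 * l.2 != 0 by rewrite gt_eqF // subr_gt0 prodlt1.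
  have -> : l.1 * (l.2 * q) = l.1 * l.2 * q by ring.
  have pab : qpoch q (l.1 * l.2 * q) M != 0.
    rewrite gt_eqF // qpoch_gt0 //.
    by rewrite mulrC prodlt1 // ?q01 // prodlt1.
  have pq k : qpoch q q k != 0 by rewrite gt_eqF // qpoch_gt0.
  have q1n k : 1 - q ^+ k.+1 != 0 by rewrite gt_eqF // subr_gt0 exprn_ilt1 // ltW.
  have qMx : q ^+ M.+1 = q ^+ x * q ^+ (M - x).+1 by rewrite -exprD; congr (_ ^+ _); lia.
  have := q1n M; rewrite qMx => q1M.
  have := q1n (M - x)%N; set u := q ^+ x; set v := q ^+ (M - x).+1 => q1x.
  have u0 : u != 0 by exact: qX_neq0.
  rewrite (exprS l.1).
  field.
  by rewrite ?pab ?u0 q1x !pq ab0.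
Qed.

(** Induction on [M] for all parameters at once: [bracket F M.+1] is [cofac] minus a multiple of
    [eta F 0 - eta F x], so the sum splits into a lowered and a raised measure of size [M]. *)
Lemma op_meas_sum (F : op_family) (l : op_param R F) (M : nat) :
  admissible l -> \sum_(0 <= x < M.+1) op_meas q x M l = 1.
Proof.
elim: M l => [|M IH] l ladm.
  rewrite big_nat1; case: F l ladm => /= l; rewrite /krawtchouk_meas /hahn_meas /qhahn_meas.
  - by rewrite !expr0 bin0 !mulr1.
  - by rewrite !poch0 bin0 !mul1r invr1.
  - by rewrite !qpoch0 expr0 !mulr1 divr1 mulr1.
have bM : bracket F M.+1 != 0.
  case: (F) => /=; rewrite ?pnatr_eq0 // gt_eqF // subr_gt0 exprn_ilt1 ?ltW //.
  by case/andP: q01.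
apply: (mulfI bM); rewrite mulr1 mulr_sumr.
pose s : R := if F is QHahn then q ^+ M.+1 else 1.
transitivity (\sum_(0 <= x < M.+2)
   (op_meas q x M.+1 l * cofac F M.+1 x -
    s * (op_meas q x M.+1 l * (eta F 0 - eta F x)))).
  by apply: eq_bigr => x _; rewrite /cofac -/s; ring.
rewrite big_split /= sumrN -mulr_sumr big_nat_recr //= cofac_diag mulr0 addr0.
rewrite [X in s * X]big_nat_recl //= subrr mulr0 add0r.
rewrite (eq_big_nat _ _ (F2 := fun x =>
   bracket F M.+1 * (1 - mom1 l) * op_meas q x M (down_param l))); last first.
  by move=> x /= xM; rewrite op_meas_down.
rewrite [X in s * X](eq_big_nat _ _ (F2 := fun x =>
   mom1 l * (eta F 0 - eta F M.+1) * op_meas q x M (up_param l))); last first.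
  by move=> x /= xM; rewrite op_meas_up.
rewrite -!mulr_sumr (IH _ (admissible_up ladm)) (IH _ (admissible_down ladm)) !mulr1.
(* Since [cofac] vanishes on the diagonal, [s * (eta F 0 - eta F M.+1)] is [- bracket F M.+1], and
   the two weights [1 - mom1 l] and [mom1 l] add up to 1. *)
have := cofac_diag F M.+1; rewrite /cofac -/s => /eqP; rewrite addrC addr_eq0 => /eqP h.
by rewrite mulrCA h; ring.
Qed.

Lemma ffacS0 (F : op_family) (k x : nat) :
  ffac F k.+1 0 x.+1 = (eta F 0 - eta F x.+1) * ffac F k 0 x.
Proof.
rewrite /ffac big_ord_recl /=; congr (_ * _).
  by case: F => /=; rewrite ?mul1r ?expr0 ?mul1r addr0.
apply: eq_bigr => i _; rewrite /bump /= add1n.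
case: F => /=; rewrite ?mul1r; [by rewrite -!natr1; ring..|].
by rewrite !exprS invfM !addr0 mulrACA mulfV // mul1r.
Qed.

Lemma ffac00 (F : op_family) (k : nat) : ffac F k.+1 0 0 = 0.
Proof.
rewrite /ffac big_ord_recl /=.
by case: F => /=; rewrite ?expr0 ?invr1 ?mul1r subrr addr0 mul0r.
Qed.

(** Each factor is absorbed by [op_meas_up], which lowers [k] and [M] together; the constants left
    over build up [mom k l] and [ffac F k 0 M]. *)
Lemma ffac_moment0 (F : op_family) (l : op_param R F) (k M : nat) :
  admissible l ->
  \sum_(0 <= x < M.+1) op_meas q x M l * ffac F k 0 x = mom k l * ffac F k 0 M.
Proof.
elim: k M l => [|k IH] M l ladm.
  rewrite /= mul1r /ffac big_ord0 -[RHS](op_meas_sum M ladm).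
  by apply: eq_bigr => x _; rewrite big_ord0 mulr1.
rewrite big_nat_recl // ffac00 mulr0 add0r.
case: M => [|M]; first by rewrite big_geq // ffac00 mulr0.
rewrite ffacS0 (eq_big_nat _ _ (F2 := fun x => mom1 l * (eta F 0 - eta F M.+1) *
   (op_meas q x M (up_param l) * ffac F k 0 x))); last first.
  by move=> x /= xM; rewrite ffacS0 mulrA op_meas_up // mulrA.
by rewrite -mulr_sumr (IH _ _ (admissible_up ladm)) /=; ring.
Qed.

Lemma ffacD (F : op_family) (k z x : nat) :
  ffac F k z (z + x) = (if F is QHahn then q ^- z else 1) ^+ k * ffac F k 0 x.
Proof.
rewrite /ffac -[k in _ ^+ k]card_ord -prodr_const -big_split /=.
apply: eq_bigr => i _; case: F => /=; rewrite ?natrD; [by ring..|].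
by rewrite expr0 invr1 exprD invfM !addr0 mulrBr mulr1 mulrCA.
Qed.

(** Translation by [z] multiplies both sides by the same power ([ffacD]), which reduces the claim to
    [ffac_moment0]. *)
Lemma ffac_moment (F : op_family) (l : op_param R F) (k z w : nat) :
  admissible l -> (z <= w)%N ->
  \sum_(z <= x < w.+1) op_meas q (x - z) (w - z) l * ffac F k z x =
  mom k l * ffac F k z w.
Proof.
move=> ladm zw; rewrite -{1}[z]add0n big_addn -(subnKC zw) subSn ?leq_addr //.
rewrite addKn ffacD mulrCA -ffac_moment0 // mulr_sumr.
by apply: eq_bigr => x _; rewrite addnK addnC ffacD mulrCA.
Qed.

End Families.

(** * Functions of bounded degree in a set of generators *)

Section Degree.
Variable R : realType.

(** Functions agreeing on [D] with a polynomial of degree at most [n] in the functions of [G]. The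
    inductive form allows induction on how a function is built, without coefficients or
    monomials. *)
Inductive deg_le (X : Type) (D : X -> Prop) (G : (X -> R) -> Prop) :
    nat -> (X -> R) -> Prop :=
| deg_cst n c : deg_le D G n (fun=> c)
| deg_gen n g f : G g -> deg_le D G n f -> deg_le D G n.+1 (fun x => g x * f x)
| deg_add n f g : deg_le D G n f -> deg_le D G n g ->
    deg_le D G n (fun x => f x + g x)
| deg_ext n f g : (forall x, D x -> f x = g x) -> deg_le D G n f ->
    deg_le D G n g.

Variables (X : Type) (D : X -> Prop) (G : (X -> R) -> Prop).

Lemma deg_leW m n f : deg_le D G m f -> (m <= n)%N -> deg_le D G n f.
Proof.
move=> h; elim: h n => {m f} [m c|m g f Gg _ IH|m f g _ IHf _ IHg|m f g fg _ IH] n.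
- by move=> _; exact: deg_cst.
- by case: n => // n mn; apply: deg_gen => //; exact: IH.
- by move=> mn; apply: deg_add; [exact: IHf|exact: IHg].
- by move=> mn; apply: deg_ext fg _; exact: IH.
Qed.

Lemma deg_scale n c f : deg_le D G n f -> deg_le D G n (fun x => c * f x).
Proof.
move=> h; elim: h => {n f} [n b|n g f Gg _ IH|n f g _ IHf _ IHg|n f g fg _ IH].
- exact: deg_cst.
- by apply: deg_ext (deg_gen Gg IH) => x _; rewrite mulrCA.
- by apply: deg_ext (deg_add IHf IHg) => x _; rewrite mulrDr.
- by apply: deg_ext IH => x Dx; rewrite fg.
Qed.

Lemma deg_mul m n f g : deg_le D G m f -> deg_le D G n g ->
  deg_le D G (m + n) (fun x => f x * g x).
Proof.
move=> h; elim: h n g => {m f} [m c|m f' f Gf _ IH|m f1 f2 _ IH1 _ IH2|m f1 f2 f12 _ IH] n g hg.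
- by apply: deg_leW (leq_addl _ _); exact: deg_scale.
- by rewrite addSn; apply: deg_ext (deg_gen Gf (IH _ _ hg)) => x _; rewrite mulrA.
- by apply: deg_ext (deg_add (IH1 _ _ hg) (IH2 _ _ hg)) => x _; rewrite mulrDl.
- by apply: deg_ext (IH _ _ hg) => x Dx; rewrite f12.
Qed.

Lemma deg_gen1 g : G g -> deg_le D G 1 g.
Proof.
move=> Gg; apply: deg_ext (deg_gen Gg (deg_cst _ _ 0 1)) => x _.
by rewrite mulr1.
Qed.

Lemma deg_opp n f : deg_le D G n f -> deg_le D G n (fun x => - f x).
Proof. by move=> /(deg_scale (-1)); apply: deg_ext => x _; rewrite mulN1r. Qed.

Lemma deg_sub n f g : deg_le D G n f -> deg_le D G n g ->
  deg_le D G n (fun x => f x - g x).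
Proof. by move=> hf hg; apply: deg_add => //; exact: deg_opp. Qed.

Lemma deg_sum n k (f : 'I_k -> X -> R) : (forall i, deg_le D G n (f i)) ->
  deg_le D G n (fun x => \sum_(i < k) f i x).
Proof.
elim: k f => [|k IH] f h.
  by apply: deg_ext (deg_cst _ _ n 0) => x _; rewrite big_ord0.
apply: deg_ext (deg_add (IH (fun i => f (widen_ord (leqnSn k) i)) _) (h ord_max)).
  by move=> x _; rewrite big_ord_recr.
by move=> i; exact: h.
Qed.

Lemma deg_prod k (h : nat -> X -> R) : (forall i, deg_le D G 1 (h i)) ->
  deg_le D G k (fun x => \prod_(i < k) h i x).
Proof.
move=> h1; elim: k => [|k IH].
  by apply: deg_ext (deg_cst _ _ 0 1) => x _; rewrite big_ord0.
by rewrite -addn1; apply: deg_ext (deg_mul IH (h1 k)) => x _; rewrite addn1 big_ord_recr.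
Qed.

End Degree.

Lemma deg_comp (R : realType) (X Y : Type) (D : X -> Prop) (E : Y -> Prop)
    (G : (X -> R) -> Prop) (H : (Y -> R) -> Prop) (phi : X -> Y) n f :
  (forall x, D x -> E (phi x)) ->
  (forall h, H h -> deg_le D G 1 (fun x => h (phi x))) ->
  deg_le E H n f -> deg_le D G n (fun x => f (phi x)).
Proof.
move=> DE HG hf; elim: hf => {n f} [n c|n g f Hg _ IH|n f g _ IHf _ IHg|n f g fg _ IH].
- exact: deg_cst.
- by rewrite -add1n; apply: deg_mul IH; exact: HG.
- exact: deg_add.
- by apply: deg_ext IH => x /DE /fg.
Qed.

(** Varying ranges become indicators over one fixed range, so that nested sums can be exchanged and
    their ranges compared as boolean conditions. *)
Lemma sum_nat_indic (R : nzRingType) (a b B : nat) (f : nat -> R) : (b <= B)%N ->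
  \sum_(a <= x < b) f x = \sum_(x < B) (a <= x < b)%:R * f x.
Proof.
move=> bB; rewrite (big_nat_widenl a 0%N) // (big_nat_widen 0%N b B) // big_mkcond /=.
rewrite big_mkord; apply: eq_bigr => x _.
by case: ifP => h; rewrite ?h ?mul1r ?mul0r.
Qed.

(** * Averages over a point between two given points, and convolutions as iterated averages *)

Section Averages.
Variables (R : realType) (q : R) (q01 : 0 < q < 1) (F : op_family).
Local Notation eta := (eta q F).

Definition avg (l : op_param R F) (z w : nat) (f : nat -> R) : R :=
  \sum_(z <= x < w.+1) op_meas q (x - z) (w - z) l * f x.

Lemma eq_avg l z w f g : (forall x, (z <= x <= w)%N -> f x = g x) ->
  avg l z w f = avg l z w g.
Proof. by move=> fg; apply: eq_big_nat => x; rewrite ltnS => /fg ->. Qed.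

Lemma avg_cst l z w c : admissible l -> (z <= w)%N -> avg l z w (fun=> c) = c.
Proof.
move=> ladm zw; rewrite /avg -mulr_suml.
rewrite -[RHS]mul1r; congr (_ * _).
have := ffac_moment q01 0 ladm zw; rewrite {2}/ffac big_ord0 mulr1 /= => <-.
by apply: eq_bigr => x _; rewrite /ffac big_ord0 mulr1.
Qed.

Section Parametrized.
Variables (X : Type) (D : X -> Prop) (G : (X -> R) -> Prop) (z w : X -> nat).

(** The averaged point is adjoined as a new coordinate, so that nested averages are handled by
    repeated use of [deg_avg]. *)
Definition ext_dom (cx : X * nat) : Prop := D cx.1 /\ (z cx.1 <= cx.2 <= w cx.1)%N.

Definition ext_gen (g : X * nat -> R) : Prop :=
  (exists2 g0, G g0 & g = g0 \o fst) \/ g = eta \o snd.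

Hypothesis zw : forall c, D c -> (z c <= w c)%N.
Hypothesis deg_z : deg_le D G 1 (fun c => eta (z c)).
Hypothesis deg_w : deg_le D G 1 (fun c => eta (w c)).

(** Powers of the averaged variable are traded one by one for factors of [ffac], whose mean is a
    constant times [ffac q F k (z c) (w c)], of degree [k] in the ends. *)
Lemma deg_avg l m f : admissible l -> deg_le ext_dom ext_gen m f ->
  deg_le D G m (fun c => avg l (z c) (w c) (fun x => f (c, x))).
Proof.
move=> ladm hf.
(* The extra factor [ffac] of arbitrary order collects the occurrences of [eta x] met so far. *)
suff H k : deg_le D G (m + k)
    (fun c => avg l (z c) (w c) (fun x => f (c, x) * ffac q F k (z c) x)).
  rewrite -[m]addn0; apply: deg_ext (H 0%N) => c Dc.
  by apply: eq_avg => x _; rewrite /ffac big_ord0 mulr1.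
elim: hf k => {m f} [m c|m g f Gg _ IH|m f g _ IHf _ IHg|m f g fg _ IH] k.
- apply: deg_leW (leq_addl m k).
  have h : deg_le D G k (fun x => ffac q F k (z x) (w x)).
    apply: (@deg_prod _ _ D G k (fun i c => eta (z c) - ffac_scale q F i * eta (w c) +
      ffac_shift R F i)) => i; apply: deg_add (deg_cst _ _ _ _).
    by apply: deg_sub => //; exact: deg_scale.
  apply: deg_ext (deg_scale (c * mom q k l) h) => x Dx.
  rewrite -mulrA -ffac_moment // ?zw // /avg mulr_sumr.
  by apply: eq_bigr => y _; rewrite mulrCA.
- case: Gg => [[g0 Gg0 ->]|->] /=.
    rewrite addSn; apply: deg_ext (deg_gen Gg0 (IH k)) => c _.
    by rewrite /avg mulr_sumr; apply: eq_bigr => x _; ring.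
  (* The last factor of [ffac q F k.+1] is solved for [eta x]: scale times [eta x] times [ffac k] is
     [(eta z + shift)] times [ffac k], minus [ffac k.+1], all of degree at most [m.+1 + k]. *)
  have s0 : ffac_scale q F k != 0.
    by case: (F) => /=; rewrite ?oner_eq0 ?expf_neq0 // gt_eqF //; case/andP: q01.
  have h1 := deg_mul deg_z (IH k); rewrite add1n -addSn in h1.
  have h2 := deg_scale (ffac_shift R F k) (IH k).
  have h3 := IH k.+1; rewrite addnS -addSn in h3.
  have h2' : deg_le D G (m.+1 + k) _ := deg_leW h2 (leq_add (leqnSn m) (leqnn k)).
  have := deg_scale (ffac_scale q F k)^-1 (deg_sub (deg_add h1 h2') h3).
  apply: deg_ext => c _.
  rewrite /avg !mulr_sumr -big_split -sumrB mulr_sumr /=; apply: eq_bigr => x _.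
  rewrite /ffac (big_ord_recr k) /=.
  by field.
- by apply: deg_ext (deg_add (IHf k) (IHg k)) => c _; rewrite /avg -big_split /=;
    apply: eq_bigr => x _; rewrite -mulrDr mulrDl.
- apply: deg_ext (IH k) => c Dc; apply: eq_avg => x /= xzw.
  by rewrite fg.
Qed.

Lemma deg_ext_fst m f : deg_le D G m f ->
  deg_le ext_dom ext_gen m (fun cx => f cx.1).
Proof.
apply: deg_comp => [x []//|h Gh].
by apply: deg_gen1; left; exists h.
Qed.

Lemma deg_ext_snd : deg_le ext_dom ext_gen 1 (fun cx => eta cx.2).
Proof. by apply: deg_gen1; right. Qed.

End Parametrized.

Definition eta_gen (g : nat -> R) : Prop := g = eta.

Lemma avg_indic N l z w f : (w <= N)%N -> avg l z w f =
  \sum_(x < N.+1) (z <= x <= w)%:R * (op_meas q (x - z) (w - z) l * f x).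
Proof. by move=> wN; rewrite /avg (@sum_nat_indic _ _ _ N.+1). Qed.

Lemma indic_congr (b : bool) (u v : R) : (b -> u = v) -> b%:R * u = b%:R * v.
Proof. by case: b => [->|_]; rewrite ?mul0r. Qed.

(** After exchanging sums, the intermediate points are chosen starting from [y] and [x] comes last,
    each point between two bounds depending on [y] and the earlier points. *)
Lemma conv_avg C N l1 l2 l3 y (f : nat -> R) : (y <= N)%N ->
  \sum_(x < N.+1) conv_entry q C N l1 l2 l3 x y * f x =
  match C with
  | ConvI => avg l1 0 y (fun z => avg l2 z N f)
  | ConvII => avg l1 0 y (fun z => avg l2 z (z + (N - y)) f)
  | ConvIII => avg l1 y N (fun z => avg l2 0 z f)
  | ConvIV => avg l1 0 y (fun z2 => avg l2 y N (fun z1 => avg l3 z2 z1 f))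
  | ConvV =>
      avg l1 0 y (fun z2 => avg l2 y N (fun z1 => avg l3 z2 (z2 + (z1 - y)) f))
  end.
Proof.
have indM (a b : bool) : a%:R * b%:R = (a && b)%:R :> R by rewrite -natrM mulnb.
have ind0 (z : nat) : (0 <= z)%N%:R = 1 :> R by [].
move=> yN; have mB x : ((minn x y).+1 <= N.+1)%N by rewrite ltnS geq_min yN orbT.
case: C => /=.
- under eq_bigr => x _ do rewrite (sum_nat_indic _ _ (mB x)) mulr_suml.
  rewrite exchange_big /= (avg_indic _ _ _ yN); apply: eq_bigr => z _.
  rewrite (avg_indic _ _ _ (leqnn N)) !mulr_sumr; apply: eq_bigr => x _.
  have -> : (z < (minn x y).+1)%N = (0 <= z <= y)%N && (z <= x <= N)%N by have := ltn_ord x; lia.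
  by rewrite -!indM ?ind0 !subn0; ring.
- under eq_bigr => x _ do rewrite (sum_nat_indic _ _ (mB x)) mulr_suml.
  rewrite exchange_big /= (avg_indic _ _ _ yN); apply: eq_bigr => z _.
  (* The upper end [z + (N - y)] stays within [N] only when [z <= y], so the inner average is
     expanded under that indicator. *)
  rewrite [RHS](indic_congr (v := \sum_(x < N.+1) op_meas q (z - 0) (y - 0) l1 *
    ((z <= x <= z + (N - y))%:R * (op_meas q (x - z) (N - y) l2 * f x)))); last first.
    by move=> zy; rewrite (@avg_indic N) ?mulr_sumr ?addKn //; lia.
  rewrite mulr_sumr; apply: eq_bigr => x _.
  have -> : (x + y - N <= z < (minn x y).+1)%N =
    (0 <= z <= y)%N && (z <= x <= z + (N - y))%N by have := ltn_ord x; lia.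
  by rewrite -!indM ?ind0 !subn0; ring.
- under eq_bigr => x _ do rewrite (sum_nat_indic _ _ (leqnn N.+1)) mulr_suml.
  rewrite exchange_big /= (avg_indic _ _ _ (leqnn N)); apply: eq_bigr => z _.
  rewrite (@avg_indic N); last by have := ltn_ord z; lia.
  rewrite !mulr_sumr; apply: eq_bigr => x _.
  have -> : (maxn x y <= z < N.+1)%N = (y <= z <= N)%N && (0 <= x <= z)%N by have := ltn_ord x; lia.
  by rewrite -!indM ?ind0 !subn0; ring.
- under eq_bigr => x _.
    rewrite (sum_nat_indic _ _ (mB x)) mulr_suml.
    under eq_bigr => z _ do
      rewrite (sum_nat_indic _ _ (leqnn N.+1)) !mulr_sumr mulr_suml.
    over.
  rewrite exchange_big /= (avg_indic _ _ _ yN); apply: eq_bigr => z2 _.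
  rewrite exchange_big /= (avg_indic _ _ _ (leqnn N)) !mulr_sumr.
  apply: eq_bigr => z1 _.
  rewrite (@avg_indic N); last by have := ltn_ord z1; lia.
  rewrite !mulr_sumr; apply: eq_bigr => x _.
  have h : (z2 < (minn x y).+1)%N && (maxn x y <= z1 < N.+1)%N =
    [&& (0 <= z2 <= y)%N, (y <= z1 <= N)%N & (z2 <= x <= z1)%N] by have := ltn_ord x; lia.
  transitivity (((z2 < (minn x y).+1)%N && (maxn x y <= z1 < N.+1)%N)%:R *
     (op_meas q z2 y l1 * op_meas q (x - z2) (z1 - z2) l3 *
      op_meas q (z1 - y) (N - y) l2 * f x)); first by rewrite -indM; ring.
  by rewrite h -!indM ?ind0 !subn0; ring.
- under eq_bigr => x _.
    rewrite (sum_nat_indic _ _ (mB x)) mulr_suml.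
    under eq_bigr => z _ do
      rewrite (sum_nat_indic _ _ (leqnn N.+1)) !mulr_sumr mulr_suml.
    over.
  rewrite exchange_big /= (avg_indic _ _ _ yN); apply: eq_bigr => z2 _.
  rewrite exchange_big /= (avg_indic _ _ _ (leqnn N)) !mulr_sumr.
  apply: eq_bigr => z1 _.
  (* Both indicators are brought to the front: the bound [z2 + (z1 - y) <= N] rests on both. *)
  rewrite [RHS](_ : _ = ((0 <= z2 <= y)%N && (y <= z1 <= N)%N)%:R *
     (op_meas q (z2 - 0) (y - 0) l1 * (op_meas q (z1 - y) (N - y) l2 *
      avg l3 z2 (z2 + (z1 - y)) f))); last by rewrite -!indM; ring.
  rewrite [RHS](indic_congr (v := \sum_(x < N.+1) op_meas q (z2 - 0) (y - 0) l1 *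
     (op_meas q (z1 - y) (N - y) l2 *
    ((z2 <= x <= z2 + (z1 - y))%:R * (op_meas q (x - z2) (z1 - y) l3 * f x))))); last first.
    by move=> zy; rewrite (@avg_indic N) ?mulr_sumr ?addKn //; lia.
  rewrite mulr_sumr; apply: eq_bigr => x _.
  have h : (z2 < (minn x y).+1)%N && (x + y - z2 <= z1 < N.+1)%N =
    ((0 <= z2 <= y)%N && (y <= z1 <= N)%N) && (z2 <= x <= z2 + (z1 - y))%N by have := ltn_ord x; lia.
  transitivity (((z2 < (minn x y).+1)%N && (x + y - z2 <= z1 < N.+1)%N)%:R *
     (op_meas q z2 y l1 * op_meas q (x - z2) (z1 - y) l3 *
      op_meas q (z1 - y) (N - y) l2 * f x)); first by rewrite -indM; ring.
  by rewrite h -!indM ?ind0 !subn0; ring.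
Qed.

End Averages.

(** * Convolutions preserve degrees, have column sums 1 and positive entries *)

Section Convolutions.
Variables (R : realType) (q : R) (q01 : 0 < q < 1) (F : op_family) (N : nat).
Local Notation eta := (eta q F).

Definition upto (x : nat) : Prop := (x <= N)%N.

Lemma deg_eta : deg_le upto (eta_gen q F) 1 eta.
Proof. exact: deg_gen1. Qed.

(** The averages of [conv_avg] are peeled off from the outside by [deg_avg]; at each level [eta] of
    both ends must have degree 1 in the points already chosen. *)
Lemma conv_deg C (l1 l2 l3 : op_param R F) m f : allowed F C ->
  admissible l1 -> admissible l2 -> admissible l3 ->
  deg_le upto (eta_gen q F) m f ->
  deg_le upto (eta_gen q F) m
    (fun y => \sum_(x < N.+1) conv_entry q C N l1 l2 l3 x y * f x).
Proof.
move=> FC h1 h2 h3 hf.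
apply: deg_ext => [y yN|]; first by rewrite conv_avg //; reflexivity.
have davg X D G (z w : X -> nat) := @deg_avg R q q01 F X D G z w.
have cst X (D : X -> Prop) G c : deg_le D G 1 (fun=> eta c) by exact: deg_cst.
have leaf X (D : X -> Prop) G (phi : X -> nat) : (forall c, D c -> phi c <= N)%N ->
    deg_le D G 1 (fun c => eta (phi c)) -> deg_le D G m (fun c => f (phi c)).
  move=> phiN dphi; apply: (@deg_comp _ _ _ _ upto _ (eta_gen q F)) hf => //.
  by move=> h ->.
have fst1 X D G z w := @deg_ext_fst R q F X D G z w 1.
case: C FC => FC.
- apply: (davg _ _ _ (fun=> 0%N) id _ _ _ l1 m (fun c => avg q l2 c.2 N f)) => //;
    first exact: deg_eta.
  apply: (davg _ _ _ snd (fun=> N) _ _ _ l2 m (fun c => f c.2)) => //.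
  + by move=> [y z] []; rewrite /upto /=; lia.
  + exact: deg_ext_snd.
  + apply: leaf; last exact: deg_ext_snd.
    by move=> [[y z] x] [[]]; rewrite /upto /=; lia.
- apply: (davg _ _ _ (fun=> 0%N) id _ _ _ l1 m
    (fun c => avg q l2 c.2 (c.2 + (N - c.1)) f)) => //; first exact: deg_eta.
  apply: (davg _ _ _ snd (fun c => c.2 + (N - c.1))%N _ _ _ l2 m (fun c => f c.2)) => //.
  + by move=> [y z] []; rewrite /upto /=; lia.
  + exact: deg_ext_snd.
  (* [eta (z + (N - y))] is affine in [eta y] and [eta z] for Krawtchouk and Hahn; for q-Hahn it
     would involve a quotient, and [FC] excludes that case. *)
  + apply: deg_ext (deg_add (deg_sub (cst _ _ _ N) (fst1 _ _ _ (fun=> 0%N) id _ deg_eta))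
      (deg_ext_snd q F _ _ (fun=> 0%N) id)).
    move=> [y z] [/=]; rewrite /upto => yN zy.
    by case: (F) FC => //= _; rewrite natrD natrB //; ring.
  + apply: leaf; last exact: deg_ext_snd.
    by move=> [[y z] x] [[]]; rewrite /upto /=; lia.
- apply: (davg _ _ _ id (fun=> N) _ _ _ l1 m (fun c => avg q l2 0 c.2 f)) => //;
    first exact: deg_eta.
  apply: (davg _ _ _ (fun=> 0%N) snd _ _ _ l2 m (fun c => f c.2)) => //.
  + exact: deg_ext_snd.
  + apply: leaf; last exact: deg_ext_snd.
    by move=> [[y z] x] [[]]; rewrite /upto /=; lia.
- apply: (davg _ _ _ (fun=> 0%N) id _ _ _ l1 m
    (fun c => avg q l2 c.1 N (fun z1 => avg q l3 c.2 z1 f))) => //; first exact: deg_eta.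
  apply: (davg _ _ _ fst (fun=> N) _ _ _ l2 m (fun c => avg q l3 c.1.2 c.2 f)) => //.
  + by move=> [y z] [].
  + exact: fst1 deg_eta.
  apply: (davg _ _ _ (fun c => c.1.2) snd _ _ _ l3 m (fun c => f c.2)) => //.
  + by move=> [[y z2] z1] [[]]; rewrite /upto /=; lia.
  + by apply: (fst1 _ _ _ _ _ (fun c => eta c.2)); exact: deg_ext_snd.
  + exact: deg_ext_snd.
  + apply: leaf; last exact: deg_ext_snd.
    by move=> [[[y z2] z1] x] [[[]]]; rewrite /upto /=; lia.
- apply: (davg _ _ _ (fun=> 0%N) id _ _ _ l1 m
    (fun c => avg q l2 c.1 N (fun z1 => avg q l3 c.2 (c.2 + (z1 - c.1)) f))) => //;
    first exact: deg_eta.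
  apply: (davg _ _ _ fst (fun=> N) _ _ _ l2 m
    (fun c => avg q l3 c.1.2 (c.1.2 + (c.2 - c.1.1)) f)) => //.
  + by move=> [y z] [].
  + exact: fst1 deg_eta.
  apply: (davg _ _ _ (fun c => c.1.2) (fun c => c.1.2 + (c.2 - c.1.1))%N _ _ _ l3 m
    (fun c => f c.2)) => //.
  + by move=> c _; exact: leq_addr.
  + by apply: (fst1 _ _ _ _ _ (fun c => eta c.2)); exact: deg_ext_snd.
  + have dy := fst1 _ _ _ fst (fun=> N) _ (fst1 _ _ _ (fun=> 0%N) id _ deg_eta).
    have dz2 := fst1 _ _ _ fst (fun=> N) (fun c => eta c.2)
      (deg_ext_snd q F upto (eta_gen q F) (fun=> 0%N) id).
    apply: deg_ext (deg_sub (deg_add dz2 (deg_ext_snd q F _ _ _ _)) dy).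
    move=> [[y z2] z1] [/= _ /andP[yz1 _]].
    by case: (F) FC => //= _; rewrite natrD natrB //; ring.
  + apply: leaf; last exact: deg_ext_snd.
    by move=> [[[y z2] z1] x] [[[]]]; rewrite /upto /=; lia.
Qed.

Lemma conv_cst C (l1 l2 l3 : op_param R F) y :
  admissible l1 -> admissible l2 -> admissible l3 -> (y <= N)%N ->
  \sum_(x < N.+1) conv_entry q C N l1 l2 l3 x y = 1.
Proof.
move=> h1 h2 h3 yN.
transitivity (\sum_(x < N.+1) conv_entry q C N l1 l2 l3 x y * (fun=> 1) (x : nat)).
  by apply: eq_bigr => x _; rewrite mulr1.
rewrite (conv_avg q01 C l1 l2 l3 (fun=> 1) yN); case: C.
- by rewrite -[RHS](avg_cst q01 1 h1 (leq0n y)); apply: eq_avg => z ?; rewrite avg_cst //; lia.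
- by rewrite -[RHS](avg_cst q01 1 h1 (leq0n y)); apply: eq_avg => z ?; rewrite avg_cst //; lia.
- by rewrite -[RHS](avg_cst q01 1 h1 yN); apply: eq_avg => z ?; rewrite avg_cst //; lia.
- rewrite -[RHS](avg_cst q01 1 h1 (leq0n y)); apply: eq_avg => z2 ?.
  by rewrite -[RHS](avg_cst q01 1 h2 yN); apply: eq_avg => z1 ?; rewrite avg_cst //; lia.
- rewrite -[RHS](avg_cst q01 1 h1 (leq0n y)); apply: eq_avg => z2 ?.
  by rewrite -[RHS](avg_cst q01 1 h2 yN); apply: eq_avg => z1 ?; rewrite avg_cst //; lia.
Qed.

(** No summand is negative, so one positive summand suffices: at 0 in (i), at [minn x y] in (ii), at
    [N] in (iii), with 0 or [minn x y] combined with [N] in (iv) and (v). *)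
Lemma conv_gt0 C (l1 l2 l3 : op_param R F) x y :
  admissible l1 -> admissible l2 -> admissible l3 -> (x <= N)%N -> (y <= N)%N ->
  0 < conv_entry q C N l1 l2 l3 x y.
Proof.
move=> h1 h2 h3 xN yN.
have ge0 (l : op_param R F) u M : admissible l -> 0 <= op_meas q u M l.
  by move=> hl; case: (leqP u M) => uM; [rewrite ltW ?op_meas_gt0|rewrite op_meas_out].
have sum_gt0 a b (g : nat -> R) z : (a <= z < b)%N -> (forall i, 0 <= g i) -> 0 < g z ->
    0 < \sum_(a <= i < b) g i.
  move=> zab g0 gz; rewrite (bigD1_seq z) ?mem_index_iota ?iota_uniq //=.
  by rewrite ltr_wpDr // sumr_ge0.
case: C => /=.
- apply: (sum_gt0 _ _ _ 0%N) => // [i|]; first by rewrite mulr_ge0 // ge0.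
  by rewrite mulr_gt0 // op_meas_gt0 // !subn0.
- apply: (sum_gt0 _ _ _ (minn x y)) => [|i|]; first by lia.
    by rewrite mulr_ge0 // ge0.
  by rewrite mulr_gt0 // op_meas_gt0 //; lia.
- apply: (sum_gt0 _ _ _ N) => [|i|]; first by lia.
    by rewrite mulr_ge0 // ge0.
  by rewrite mulr_gt0 // op_meas_gt0.
- apply: (sum_gt0 _ _ _ 0%N) => // [i|].
    by rewrite mulr_ge0 ?ge0 ?sumr_ge0 // => j _; rewrite mulr_ge0 // ge0.
  rewrite mulr_gt0 ?op_meas_gt0 //; apply: (sum_gt0 _ _ _ N) => [|i|]; first by lia.
    by rewrite mulr_ge0 // ge0.
  by rewrite mulr_gt0 // op_meas_gt0 // !subn0.
- apply: (sum_gt0 _ _ _ (minn x y)) => // [|i|]; first by lia.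
    by rewrite mulr_ge0 ?ge0 ?sumr_ge0 // => j _; rewrite mulr_ge0 // ge0.
  rewrite mulr_gt0 ?op_meas_gt0 //; first by lia.
  apply: (sum_gt0 _ _ _ N) => [|i|]; first by lia.
    by rewrite mulr_ge0 // ge0.
  by rewrite mulr_gt0 // op_meas_gt0 //; lia.
Qed.

End Convolutions.

(** * Orthogonality through (q-)differences in the summation index *)

Section Orthogonality.
Variables (R : realType) (q : R) (q01 : 0 < q < 1).

Let q_gt0 : 0 < q. Proof. by case/andP: q01. Qed.
Let q_neq0 : q != 0. Proof. by rewrite gt_eqF. Qed.
Let q_lt1 : q < 1. Proof. by case/andP: q01. Qed.

(** The variable is now the summation index of the series for P_n, not the point [x]; hence q^k
    instead of q^(-x). *)
Definition node (F : op_family) (k : nat) : R :=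
  if F is QHahn then q ^+ k else k%:R.

Definition node_gen (F : op_family) (g : nat -> R) : Prop := g = node F.

(** (-n)_k/k! is (-1)^k C(n,k), so these are the weights of an n-th difference up to sign, and of
    its q-analogue. *)
Definition diff_weight (F : op_family) (n k : nat) : R :=
  if F is QHahn then qpoch q (q ^- n) k / qpoch q q k * q ^+ k
  else poch (- n%:R) k / k`!%:R.

Lemma qpochqq_neq0 k : qpoch q q k != 0.
Proof. by rewrite gt_eqF // qpoch_gt0. Qed.

(** Partial sums close up: the sum of (a)_k/k! over k <= m is (a+1)_m/m!, which contains the factor
    0 for a = -(n+1) and m = n+1. The q-case is analogous. *)
Lemma diff_weight_sum (F : op_family) (n : nat) :
  \sum_(k < n.+2) diff_weight F n.+1 k = 0.
Proof.
have H1 a m : \sum_(k < m.+1) poch a k / k`!%:R = poch (a + 1) m / m`!%:R :> R.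
  elim: m => [|m IH]; first by rewrite big_ord1 !poch0.
  rewrite big_ord_recr /= IH pochS pochSr factS natrM -natr1.
  field; rewrite natr1 !pnatr_eq0 -lt0n fact_gt0 //.
have H2 a m : \sum_(k < m.+1) qpoch q a k / qpoch q q k * q ^+ k =
    qpoch q (a * q) m / qpoch q q m.
  elim: m => [|m IH]; first by rewrite big_ord1 !qpoch0 expr0 mulr1.
  rewrite big_ord_recr /= IH (qpochS _ a) !(qpochSr _ _ m) -!exprS.
  have q1m : 1 - q ^+ m.+1 != 0 by rewrite gt_eqF // subr_gt0 exprn_ilt1 // ltW.
  rewrite -(mulrA a) -exprS.
  by field; rewrite q1m qpochqq_neq0.
have H1' : \sum_(k < n.+2) poch (- n.+1%:R) k / k`!%:R = 0 :> R.
  by rewrite H1 -natr1 opprD subrK pochSr addNr mulr0 mul0r.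
case: F => //=.
rewrite H2 exprS invfM mulrAC mulVf // mul1r qpochSr mulVf ?expf_neq0 //.
by rewrite subrr mulr0 mul0r.
Qed.

(** Absorption, (k+1) C(n+1,k+1) = (n+1) C(n,k), and its q-analogue: a factor of degree 1 costs one
    order of the difference. *)
Lemma diff_weight_shift (F : op_family) (n : nat) : exists c, forall k,
  diff_weight F n.+1 k.+1 * (node F k.+1 - node F 0) = c * diff_weight F n k.
Proof.
have H : exists c : R, forall k, poch (- n.+1%:R) k.+1 / k.+1`!%:R * (k.+1%:R - 0%:R)
    = c * (poch (- n%:R) k / k`!%:R).
  exists (- n.+1%:R) => k; rewrite pochS subr0 factS natrM.
  have -> : - n.+1%:R + 1 = - n%:R :> R by rewrite -natr1; ring.
  by field; rewrite nat1r !pnatr_eq0 -lt0n fact_gt0.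
case: F => //=.
exists (- (1 - q ^- n.+1) * q) => k.
have q1m : 1 - q ^+ k.+1 != 0 by rewrite gt_eqF // subr_gt0 exprn_ilt1 // ltW.
rewrite qpochS (qpochSr q q) -exprS.
have -> : q ^- n.+1 * q = q ^- n by rewrite exprS invfM mulrAC mulVf // mul1r.
rewrite expr0; move: q1m; rewrite (exprS q k) => q1m.
by field; rewrite ?qpochqq_neq0 ?q1m ?expf_neq0 ?q_neq0.
Qed.

Lemma diff_weight_deg (F : op_family) (n m : nat) (r : nat -> R) :
  deg_le (fun=> True) (node_gen F) m r -> (m < n)%N ->
  \sum_(k < n.+1) diff_weight F n k * r k = 0.
Proof.
(* Absorbing a node replaces [k] by [k.+1], so the induction must allow an arbitrary shift [c]. *)
move=> hr mn; suff H c : \sum_(k < n.+1) diff_weight F n k * r (k + c)%N = 0.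
  by rewrite -[RHS](H 0%N); apply: eq_bigr => k _; rewrite addn0.
elim: hr n mn c => {m r} [m b|m g r -> _ IH|m r s _ IHr _ IHs|m r s rs _ IH] n mn c.
- by case: n mn => // n _; rewrite -mulr_suml diff_weight_sum mul0r.
- have [u [v uv]] : exists u v, forall k,
      node F (k + c)%N = u + v * (node F k - node F 0).
    exists (node F c); exists (if F is QHahn then q ^+ c else 1) => k.
    by case: (F) => /=; rewrite ?natrD ?exprD; ring.
  transitivity (u * (\sum_(k < n.+1) diff_weight F n k * r (k + c)%N) +
     v * (\sum_(k < n.+1) diff_weight F n k * (node F k - node F 0) * r (k + c)%N)).
    by rewrite !mulr_sumr -big_split /=; apply: eq_bigr => k _; rewrite uv; ring.
  rewrite IH ?(ltnW mn) // mulr0 add0r.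
  case: n mn => // n mn; have [d hd] := diff_weight_shift F n.
  rewrite big_ord_recl subrr mulr0 mul0r add0r.
  under eq_bigr => k _ do rewrite lift0 hd addSnnS -mulrA.
  by rewrite -mulr_sumr IH // !mulr0.
- transitivity (\sum_(k < n.+1) diff_weight F n k * r (k + c)%N +
     \sum_(k < n.+1) diff_weight F n k * s (k + c)%N).
    by rewrite -big_split; apply: eq_bigr => k _; rewrite mulrDr.
  by rewrite IHr // IHs // addr0.
- by rewrite -[RHS](IH _ mn c); apply: eq_bigr => k _; rewrite rs.
Qed.

Definition Pcoef (F : op_family) (N n k : nat) : op_param R F -> R :=
  match F with
  | Krawtchouk => fun p => poch (- n%:R) k / (poch (- N%:R) k * k`!%:R) * p ^- k
  | Hahn => fun l => poch (- n%:R) k * poch (n%:R + l.1 + l.2 - 1) k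
      / (poch l.1 k * poch (- N%:R) k * k`!%:R)
  | QHahn => fun l => qpoch q (q ^- n) k * qpoch q (l.1 * l.2 * (q ^+ n / q)) k
      / (qpoch q l.1 k * qpoch q (q ^- N) k * qpoch q q k) * q ^+ k
  end.

Lemma Pcheck_ffac (F : op_family) (N n x : nat) (l : op_param R F) :
  Pcheck q N n x l = \sum_(k < n.+1) Pcoef N n k l * ffac q F k 0 x.
Proof.
have H k : poch (- x%:R) k = \prod_(i < k) (0%:R - 1 * x%:R + i%:R) :> R.
  by apply: eq_bigr => i _; rewrite mul1r sub0r.
case: F l => l; rewrite /Pcheck /krawtchouk_poly /hahn_poly /qhahn_poly /ffac /=;
  apply: eq_bigr => k _; rewrite -?H; try by ring.
rewrite (_ : \prod_(i < k) _ = qpoch q (q ^- x) k); first by ring.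
by apply: eq_bigr => i _; rewrite expr0 invr1 addr0 mulrC.
Qed.

Lemma mom_krawtchouk k (p : R) : mom q k (p : op_param R Krawtchouk) = p ^+ k.
Proof. by elim: k => //= k ->; rewrite exprS. Qed.

Lemma mom_hahn k (l : op_param R Hahn) : mom q k l = poch l.1 k / poch (l.1 + l.2) k.
Proof.
elim: k l => [|k IH] l; first by rewrite !poch0 divr1.
by rewrite [LHS]/= IH !pochS /= (addrAC l.1) invfM mulrACA.
Qed.

Lemma mom_qhahn k (l : op_param R QHahn) :
  mom q k l = qpoch q l.1 k / qpoch q (l.1 * l.2) k.
Proof.
elim: k l => [|k IH] l; first by rewrite !qpoch0 divr1.
by rewrite [LHS]/= IH !qpochS /= (mulrAC l.1) invfM mulrACA.
Qed.

Lemma iter_down_hahn j (l : op_param R Hahn) :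
  iter j (@down_param _ q Hahn) l = (l.1, l.2 + j%:R).
Proof.
elim: j => [|j IH]; first by rewrite addr0; case: l.
by rewrite iterS IH /= -natr1 addrA.
Qed.

Lemma iter_down_qhahn j (l : op_param R QHahn) :
  iter j (@down_param _ q QHahn) l = (l.1, l.2 * q ^+ j).
Proof.
elim: j => [|j IH]; first by rewrite mulr1; case: l.
by rewrite iterS IH /= exprSr mulrA.
Qed.

Lemma deg_poch (B : R) j :
  deg_le (fun=> True) (node_gen Hahn) j (fun k => poch (B + k%:R) j).
Proof.
apply: (@deg_prod _ _ _ _ j (fun i k => B + k%:R + i%:R)) => i.
apply: deg_add (deg_cst _ _ _ _); apply: deg_add; first exact: deg_cst.
exact: deg_gen1.
Qed.

Lemma deg_qpoch (B : R) j :
  deg_le (fun=> True) (node_gen QHahn) j (fun k => qpoch q (B * q ^+ k) j).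
Proof.
apply: (@deg_prod _ _ _ _ j (fun i k => 1 - B * q ^+ k * q ^+ i)) => i.
apply: deg_sub; first exact: deg_cst.
apply: (@deg_ext _ _ _ _ _ (fun k => B * q ^+ i * q ^+ k)).
  by move=> k _; rewrite mulrAC.
by apply: deg_scale; exact: deg_gen1.
Qed.

(** After cancellation each term is a difference weight times a polynomial in [node F k] of degree
    below [n]. Indeed (-(N-j))_k/(-N)_k = (-N+k)_j/(-N)_j has degree j; for Hahn, with A = a+b+j and
    i = n-1-j, also (A+i)_k/(A)_k = (A+k)_i/(A)_i has degree i. The q-Hahn case is parallel; for
    Krawtchouk the powers of p cancel. *)
Lemma Pcoef_moment0 (F : op_family) (N n j : nat) (l : op_param R F) :
  admissible l -> (j < n)%N -> (n <= N)%N ->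
  \sum_(k < n.+1) Pcoef N n k l *
    (mom q k (iter j (@down_param _ q F) l) * ffac q F k 0 (N - j)) = 0.
Proof.
move=> ladm jn nN; have jN : (j <= N)%N by lia.
have Hf k x : ffac q Hahn k 0 x = poch (- x%:R) k.
  by apply: eq_bigr => i _; rewrite /= mul1r sub0r.
have Hq k x : ffac q QHahn k 0 x = qpoch q (q ^- x) k.
  by apply: eq_bigr => i _; rewrite /= expr0 invr1 addr0 mulrC.
have [i ni] : exists i, n = (i + j).+1 by exists (n - j.+1)%N; lia.
have NK k : (k <= n)%N -> poch (- (N - j)%:R) k =
    poch (- N%:R) k * poch (- N%:R + k%:R) j / poch (- N%:R) j :> R.
  move=> kn; rewrite -poch_add addnC poch_add mulrAC mulfV ?poch_opp_nat_neq0 //.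
  by rewrite mul1r natrB // opprB addrC.
have kN (k : 'I_n.+1) : (k <= N)%N by have := ltn_ord k; lia.
case: F l ladm => l ladm.
- pose r k := (poch (- N%:R) j)^-1 * poch (- N%:R + k%:R) j : R.
  rewrite -[RHS](@diff_weight_deg Krawtchouk n j r) //; last first.
    by apply: deg_scale; exact: deg_poch.
  apply: eq_bigr => k _; rewrite (_ : iter _ _ _ = l); last by elim: (j).
  rewrite mom_krawtchouk (_ : ffac _ _ _ _ _ = ffac q Hahn k 0 (N - j)) // Hf NK.
    have l0 : l != 0 by case/andP: ladm => l0 _; rewrite gt_eqF.
    rewrite /r /=; field.
    by rewrite ?poch_opp_nat_neq0 ?kN ?expf_neq0 ?pnatr_eq0 -?lt0n ?fact_gt0.
  by rewrite -ltnS.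
- case/andP: ladm => a0 b0.
  pose A := l.1 + (l.2 + j%:R).
  have A0 m : poch A m != 0 by rewrite gt_eqF // poch_gt0 // addr_gt0 // ltr_wpDr.
  have a0' m : poch l.1 m != 0 by rewrite gt_eqF // poch_gt0.
  pose r k := (poch (- N%:R) j * poch A i)^-1 *
    (poch (- N%:R + k%:R) j * poch (A + k%:R) i) : R.
  rewrite -[RHS](@diff_weight_deg Hahn n (j + i) r) //; last 2 first.
  - by apply: deg_scale; apply: deg_mul; exact: deg_poch.
  - by lia.
  apply: eq_bigr => k _; rewrite iter_down_hahn mom_hahn Hf NK ?[(fst _)]/=; last first.
    by rewrite -ltnS.
  rewrite [Pcoef _ _ _ _]/= -/A.
  have -> : n%:R + l.1 + l.2 - 1 = A + i%:R by rewrite ni -natr1 natrD /A; ring.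
  have -> : poch (A + i%:R) k = poch A k * poch (A + k%:R) i / poch A i.
    by rewrite -poch_add addnC poch_add mulrAC mulfV ?mul1r.
  rewrite /r /=; field.
  by rewrite ?poch_opp_nat_neq0 ?kN ?A0 ?a0' ?pnatr_eq0 -?lt0n ?fact_gt0.
- case/andP: ladm => a01 b1; have a1 : l.1 < 1 by case/andP: a01.
  have qX0 m : q ^+ m != 0 by rewrite expf_neq0.
  pose A := l.1 * (l.2 * q ^+ j).
  have A0 m : qpoch q A m != 0.
    rewrite gt_eqF // qpoch_gt0 // prodlt1 // mulrC.
    case: (j) => [|j']; first by rewrite expr0 mul1r.
    by rewrite prodlt1 // exprn_gt0 // exprn_ilt1 // ltW.
  have a0' m : qpoch q l.1 m != 0 by rewrite gt_eqF // qpoch_gt0.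
  pose r k := (qpoch q (q ^- N) j * qpoch q A i)^-1 *
    (qpoch q (q ^- N * q ^+ k) j * qpoch q (A * q ^+ k) i) : R.
  rewrite -[RHS](@diff_weight_deg QHahn n (j + i) r) //; last 2 first.
  - by apply: deg_scale; apply: deg_mul; exact: deg_qpoch.
  - by lia.
  apply: eq_bigr => k _; rewrite iter_down_qhahn mom_qhahn Hq ?[(fst _)]/=.
  rewrite [Pcoef _ _ _ _]/= -/A.
  have -> : qpoch q (q ^- (N - j)) k =
      qpoch q (q ^- N) k * qpoch q (q ^- N * q ^+ k) j / qpoch q (q ^- N) j.
    rewrite -qpoch_add addnC qpoch_add mulrAC mulfV ?qpoch_opp_neq0 // mul1r.
    by rewrite -[in q ^- N](subnK jN) exprD invfM -mulrA mulVf ?mulr1.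
  have -> : l.1 * l.2 * (q ^+ n / q) = A * q ^+ i.
    by rewrite ni exprSr mulfK // addnC exprD /A; ring.
  have -> : qpoch q (A * q ^+ i) k = qpoch q A k * qpoch q (A * q ^+ k) i / qpoch q A i.
    by rewrite -qpoch_add addnC qpoch_add [RHS]mulrAC mulfV ?mul1r.
  rewrite /r /=; field.
  by rewrite ?qpoch_opp_neq0 ?kN ?A0 ?a0' ?qpochqq_neq0 ?qX0.
Qed.

Lemma cofacsS (F : op_family) j N x :
  cofacs q F j.+1 N.+1 x = cofac q F N.+1 x * cofacs q F j N x.
Proof. by rewrite /cofacs big_ord_recl. Qed.

(** [op_meas_down] is applied [j] times; the points beyond [N - j] drop out because a cofactor
    vanishes there. The constant is chosen before [f], so it is common to all terms of P_n. *)
Lemma op_meas_cofacs (F : op_family) (N j : nat) (l : op_param R F) :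
  admissible l -> (j <= N)%N ->
  exists C, forall f, \sum_(0 <= x < N.+1) op_meas q x N l * (f x * cofacs q F j N x) =
    C * \sum_(0 <= x < (N - j).+1)
      op_meas q x (N - j) (iter j (@down_param _ q F) l) * f x.
Proof.
elim: j N l => [|j IH] N l ladm jN.
  exists 1 => f; rewrite mul1r subn0; apply: eq_bigr => x _.
  by rewrite /cofacs big_ord0 mulr1.
case: N jN => // N jN; have [C hC] := IH N _ (admissible_down q01 ladm) jN.
exists (bracket q F N.+1 * (1 - mom1 l) * C) => f.
rewrite subSS iterSr -mulrA -hC big_nat_recr //= cofacsS cofac_diag // mul0r !mulr0 addr0.
rewrite mulr_sumr; apply: eq_big_nat => x; rewrite ltnS /= => xN.
rewrite cofacsS.
transitivity (op_meas q x N.+1 l * cofac q F N.+1 x * (f x * cofacs q F j N x)).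
  by ring.
by rewrite op_meas_down // !mulrA.
Qed.

Lemma Pcheck_orth_deg (F : op_family) (N n m : nat) (l : op_param R F) f :
  admissible l -> (m < n)%N -> (n <= N)%N ->
  deg_le (upto N) (eta_gen q F) m f ->
  \sum_(x < N.+1) op_meas q x N l * Pcheck q N n x l * f x = 0.
Proof.
move=> ladm mn nN hf.
(* Powers of [eta x] are traded for cofactors, as in [deg_avg]; constants are then settled by
   [Pcoef_moment0]. *)
suff H j : (m + j < n)%N ->
    \sum_(x < N.+1) op_meas q x N l * Pcheck q N n x l * (f x * cofacs q F j N x) = 0.
  rewrite -[RHS](H 0%N) ?addn0 //; apply: eq_bigr => x _.
  by rewrite /cofacs big_ord0 mulr1.
elim: hf j {mn} => {m f} [m c|m g f -> _ IH|m f g _ IHf _ IHg|m f g fg _ IH] j mj.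
- have [C hC] := op_meas_cofacs ladm (leq_trans (ltnW (leq_ltn_trans (leq_addl m j) mj)) nN).
  rewrite -(big_mkord xpredT (fun x => op_meas q x N l * Pcheck q N n x l *
    (c * cofacs q F j N x))).
  transitivity (c * \sum_(k < n.+1) Pcoef N n k l * \sum_(0 <= x < N.+1)
     op_meas q x N l * (ffac q F k 0 x * cofacs q F j N x)).
    rewrite mulr_sumr; under [RHS]eq_bigr => k _ do rewrite !mulr_sumr.
    rewrite exchange_big /=; apply: eq_big_nat => x _.
    rewrite Pcheck_ffac mulr_sumr mulr_suml; apply: eq_bigr => k _; ring.
  have jn : (j < n)%N by lia.
  transitivity (c * (C * \sum_(k < n.+1) Pcoef N n k l *
    (mom q k (iter j (@down_param _ q F) l) * ffac q F k 0 (N - j)))); last first.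
    by rewrite (Pcoef_moment0 ladm jn nN) !mulr0.
  congr (_ * _).
  rewrite [RHS]mulr_sumr; apply: eq_bigr => k _; rewrite hC ffac_moment0 //.
    by rewrite mulrCA.
  by elim: (j) => //= j' hj'; exact: admissible_down.
- have s0 : (if F is QHahn then q ^+ (N - j) else 1) != 0 :> R.
    by case: (F); rewrite ?oner_eq0 ?expf_neq0.
  set s := (if F is QHahn then q ^+ (N - j) else 1) in s0.
  have jm1 : (m + j < n)%N by lia.
  have jm2 : (m + j.+1 < n)%N by lia.
  (* The affine formula for [cofac q F (N - j) x] is solved for [eta x]; the cofactor itself raises
     [j] by one. *)
  transitivity (s^-1 * (bracket q F (N - j) + s * eta q F 0) *
     (\sum_(x < N.+1) op_meas q x N l * Pcheck q N n x l * (f x * cofacs q F j N x)) -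
     s^-1 * \sum_(x < N.+1) op_meas q x N l * Pcheck q N n x l *
       (f x * cofacs q F j.+1 N x)).
    rewrite !mulr_sumr -sumrB; apply: eq_bigr => x _.
    rewrite /cofacs big_ord_recr /= /cofac -/s; field.
    exact: s0.
  by rewrite !IH // !mulr0 subrr.
- transitivity ((\sum_(x < N.+1) op_meas q x N l * Pcheck q N n x l * (f x * cofacs q F j N x)) +
     \sum_(x < N.+1) op_meas q x N l * Pcheck q N n x l * (g x * cofacs q F j N x)).
    by rewrite -big_split; apply: eq_bigr => x _ /=; ring.
  by rewrite IHf // IHg // addr0.
- rewrite -[RHS](IH j mj); apply: eq_bigr => x _; rewrite fg //.
  by rewrite /upto -ltnS.
Qed.

Lemma Pcheck_deg (F : op_family) (N n : nat) (l : op_param R F) :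
  deg_le (upto N) (eta_gen q F) n (fun x => Pcheck q N n x l).
Proof.
apply: deg_ext => [x _|]; first by rewrite Pcheck_ffac; reflexivity.
apply: (@deg_sum _ _ _ _ n n.+1 (fun k x => Pcoef N n k l * ffac q F k 0 x)) => k.
apply: deg_scale; apply: (@deg_leW _ _ _ _ k); last by rewrite -ltnS.
apply: (@deg_prod _ _ _ _ k
  (fun i x => eta q F 0 - ffac_scale q F i * eta q F x + ffac_shift R F i)) => i.
apply: deg_add; last exact: deg_cst.
apply: deg_sub; first exact: deg_cst.
by apply: deg_scale; exact: deg_eta.
Qed.

Lemma Pcheck_n0 (F : op_family) (N n : nat) (l : op_param R F) : Pcheck q N n 0 l = 1.
Proof.
rewrite Pcheck_ffac big_ord_recl big1 => [|k _]; last by rewrite lift0 ffac00 mulr0.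
rewrite addr0 /ffac big_ord0 mulr1; case: F l => l /=;
  by rewrite ?poch0 ?qpoch0 ?expr0 ?invr1 ?mulr1 ?divr1.
Qed.

Lemma Pcheck_0x (F : op_family) (N x : nat) (l : op_param R F) : Pcheck q N 0 x l = 1.
Proof.
rewrite -[RHS](Pcheck_n0 N 0 l) !Pcheck_ffac !big_ord1.
by rewrite /ffac !big_ord0.
Qed.

End Orthogonality.

(** * Spectral expansion of matrix powers from orthogonal eigenvectors *)

Section Spectral.
Variables (R : realType) (N : nat) (w d : 'I_N.+1 -> R) (P : 'I_N.+1 -> 'I_N.+1 -> R).
Hypothesis d_gt0 : forall n, 0 < d n.
Hypothesis orth : forall m n,
  \sum_x w x * P m x * P n x = (m == n)%:R / d n ^+ 2.

Let d_neq0 n : d n != 0. Proof. by rewrite gt_eqF. Qed.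

(** Orthonormality reads A B = 1 for square matrices, hence B A = 1, which is the completeness
    relation. *)
Lemma orth_complete x y : \sum_n d n ^+ 2 * P n x * (P n y * w y) = (x == y)%:R.
Proof.
pose A := \matrix_(n, z) (d n * P n z) : 'M[R]_N.+1.
pose B := \matrix_(z, n) (w z * (d n * P n z)) : 'M[R]_N.+1.
have /mulmx1C BA : A *m B = 1%:M.
  apply/matrixP => m n; rewrite !mxE.
  transitivity (d m * d n * \sum_x w x * P m x * P n x).
    by rewrite mulr_sumr; apply: eq_bigr => z _; rewrite !mxE; ring.
  rewrite orth; have [->|_] := eqVneq m n; last by rewrite mul0r mulr0.
  by rewrite mul1r expr2 mulfV // mulf_neq0.
have := congr1 (fun M : 'M[R]_N.+1 => M y x) BA; rewrite !mxE eq_sym => <-.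
by apply: eq_bigr => n _; rewrite !mxE; ring.
Qed.

Lemma orth_expansion (f : 'I_N.+1 -> R) x :
  f x = \sum_n d n ^+ 2 * P n x * \sum_y w y * P n y * f y.
Proof.
transitivity (\sum_y (x == y)%:R * f y).
  rewrite (bigD1 x) //= eqxx mul1r big1 ?addr0 // => y.
  by rewrite eq_sym => /negPf ->; rewrite mul0r.
under eq_bigr => y _ do rewrite -orth_complete mulr_suml.
rewrite exchange_big; apply: eq_bigr => n _; rewrite mulr_sumr.
by apply: eq_bigr => y _; ring.
Qed.

Variables (K : 'M[R]_N.+1) (kappa : 'I_N.+1 -> R).
Hypothesis eigen : forall n x,
  \sum_y K x y * (w y * P n y) = kappa n * (w x * P n x).

Lemma eigen_expr l n x :
  \sum_y (K ^+ l) x y * (w y * P n y) = kappa n ^+ l * (w x * P n x).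
Proof.
elim: l x => [|l IH] x.
  rewrite !expr0 mul1r (bigD1 x) //= !mxE eqxx mul1r big1 ?addr0 // => y.
  by rewrite !mxE eq_sym => /negPf ->; rewrite mul0r.
rewrite !exprS -mulrA (mulrCA (kappa n)) -mulrCA.
transitivity (\sum_z K x z * \sum_y (K ^+ l) z y * (w y * P n y)).
  under [RHS]eq_bigr => z _ do rewrite mulr_sumr.
  rewrite exchange_big /=; apply: eq_bigr => y _.
  by rewrite [(K * _) x y]mxE mulr_suml; apply: eq_bigr => z _; ring.
under eq_bigr => z _ do rewrite IH mulrCA.
by rewrite -mulr_sumr eigen; ring.
Qed.

(** Column [y] of [K ^+ l] is the image of a unit vector, which completeness expands in the
    eigenvectors [w x * P n x]. *)
Lemma expr_spectral l x y :
  (K ^+ l) x y = w x * \sum_n d n ^+ 2 * kappa n ^+ l * P n x * P n y.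
Proof.
transitivity (\sum_z (K ^+ l) x z * (y == z)%:R).
  rewrite (bigD1 y) //= eqxx mulr1 big1 ?addr0 // => z.
  by rewrite eq_sym => /negPf ->; rewrite mulr0.
under eq_bigr => z _ do rewrite -orth_complete mulr_sumr.
rewrite exchange_big mulr_sumr; apply: eq_bigr => n _.
transitivity (d n ^+ 2 * P n y * \sum_z (K ^+ l) x z * (w z * P n z)).
  by rewrite mulr_sumr; apply: eq_bigr => z _; ring.
by rewrite eigen_expr; ring.
Qed.

Lemma chain_expr (p : nat -> 'I_N.+1 -> R) l x :
  (forall l x, p l.+1 x = \sum_y K x y * p l y) ->
  p l x = \sum_y (K ^+ l) x y * p 0%N y.
Proof.
move=> pS; elim: l x => [|l IH] x.
  rewrite (bigD1 x) //= !mxE eqxx mul1r big1 ?addr0 // => y.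
  by rewrite !mxE eq_sym => /negPf ->; rewrite mul0r.
rewrite pS exprS; under eq_bigr => y _ do rewrite IH mulr_sumr.
rewrite exchange_big /=; apply: eq_bigr => y _.
by rewrite [(K * _) x y]mxE mulr_suml; apply: eq_bigr => z _; ring.
Qed.

Lemma chain_spectral (p : nat -> 'I_N.+1 -> R) l x :
  (forall l x, p l.+1 x = \sum_y K x y * p l y) ->
  p l x = w x * \sum_n (d n * \sum_y P n y * p 0%N y) * d n * kappa n ^+ l * P n x.
Proof.
move=> pS; rewrite (chain_expr l x pS).
under eq_bigr => y _ do rewrite expr_spectral -mulrA mulr_suml.
rewrite -mulr_sumr exchange_big /=; congr (_ * _); apply: eq_bigr => n _.
rewrite mulr_sumr !mulr_suml; apply: eq_bigr => y _; ring.
Qed.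

End Spectral.

(** * Convergence of spectral sums and the maximum principle *)

Lemma cvg_spectral_sum (R : realType) (N : nat) (a kappa : 'I_N.+1 -> R) :
  kappa ord0 = 1 -> (forall n, n != ord0 -> -1 < kappa n < 1) ->
  \sum_n a n * kappa n ^+ l @[l --> \oo] --> a ord0.
Proof.
move=> k0 k1.
(* The limit is also written as a sum over [n], so that convergence is checked termwise. *)
have -> : a ord0 = \sum_n a n * (n == ord0)%:R.
  rewrite (bigD1 ord0) //= mulr1 big1 ?addr0 // => n /negPf ->.
  by rewrite mulr0.
apply: cvg_big; first exact: add_continuous.
move=> n _; apply: cvgMl_tmp; have [->|n0] := eqVneq n ord0.
  by apply: cvg_near_cst; apply: nearW => l; rewrite k0 expr1n.
by apply: cvg_expr; rewrite ltr_norml; exact: k1.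
Qed.

(* At a maximum of |f|, both M - f and M + f average to something positive
   because f takes both signs. *)
Lemma eigenvalue_lt1 (R : realType) (N : nat) (K : 'M[R]_N.+1) (k : R)
    (f : 'I_N.+1 -> R) x0 x1 :
  (forall x y, 0 < K x y) -> (forall y, \sum_x K x y = 1) ->
  (forall y, \sum_x K x y * f x = k * f y) -> 0 < f x0 -> f x1 < 0 ->
  -1 < k < 1.
Proof.
move=> K0 K1 kf f0 f1.
have [y yP] : exists y, forall x, `|f x| <= `|f y|.
  case: (@real_arg_maxP _ _ x0 xpredT (fun x => `|f x|)) => // y _ yP.
  by exists y => x; exact: yP.
set M := `|f y| in yP.
have M0 : 0 < M by apply: lt_le_trans (yP x0); rewrite gtr0_norm.
have pos g z : (forall x, 0 <= g x) -> 0 < g z -> 0 < \sum_x K x y * g x.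
  move=> g0 gz; rewrite (bigD1 z) //= ltr_wpDr ?mulr_gt0 ?sumr_ge0 // => x _.
  by rewrite mulr_ge0 // ltW.
have fM x : - M <= f x <= M by rewrite -ler_norml.
have hm : 0 < \sum_x K x y * (M - f x).
  apply: (pos (fun x => M - f x) x1) => [x|]; last by lra.
  by have := fM x; lra.
have hp : 0 < \sum_x K x y * (M + f x).
  apply: (pos (fun x => M + f x) x0) => [x|]; last by lra.
  by have := fM x; lra.
have e1 : \sum_x K x y * (M - f x) = M - k * f y.
  rewrite -kf -[M in RHS]mul1r -(K1 y) mulr_suml -sumrB.
  by apply: eq_bigr => x _; ring.
have e2 : \sum_x K x y * (M + f x) = M + k * f y.
  rewrite -kf -[M in RHS]mul1r -(K1 y) mulr_suml -big_split.
  by apply: eq_bigr => x _ /=; ring.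
rewrite e1 in hm; rewrite e2 in hp.
have kM : `|k| * M < M by rewrite -normrM ltr_norml; apply/andP; split; lra.
by rewrite -ltr_norml -(ltr_pM2r M0) mul1r.
Qed.

(** * The reversible chain: norms, existence of eigenvalues and their range *)

Section Reversible.
Variables (R : realType) (q : R) (q01 : 0 < q < 1) (F : op_family) (N : nat).
Variables (l1 l2 l3 lam : op_param R F) (C : convolution).
Hypothesis FC : allowed F C.
Hypotheses (l1_adm : admissible l1) (l2_adm : admissible l2) (l3_adm : admissible l3).
Hypothesis lam_adm : admissible lam.
Local Notation w x := (op_meas q x N lam).
Local Notation P n x := (Pcheck q N n x lam).
Local Notation K := (conv_mx q C N l1 l2 l3).
Hypothesis K_rev : forall x y : 'I_N.+1, K x y * w y = K y x * w x.

Lemma w_gt0 (x : 'I_N.+1) : 0 < w x.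
Proof. by rewrite op_meas_gt0 // -ltnS. Qed.

Lemma Pcheck_orth (m n : 'I_N.+1) : m != n -> \sum_(x < N.+1) w x * P m x * P n x = 0.
Proof.
have H (i j : 'I_N.+1) : (i < j)%N -> \sum_(x < N.+1) w x * P j x * P i x = 0.
  by move=> ij; apply: (Pcheck_orth_deg q01 lam_adm ij _ (Pcheck_deg _ _ _ _)); rewrite -ltnS.
rewrite -val_eqE /= neq_ltn => /orP[mn|nm]; last exact: H.
by rewrite -[RHS](H _ _ mn); apply: eq_bigr => x _; rewrite mulrAC.
Qed.

Lemma norm_consts_exist : exists d : 'I_N.+1 -> R, norm_consts q lam d.
Proof.
pose nn (n : nat) := \sum_(x < N.+1) w x * P n x * P n x.
have nn0 n : 0 < nn n.
  (* The norm is positive because of the term at 0, where P_n equals 1. *)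
  rewrite /nn (bigD1 ord0) //= ltr_wpDr ?sumr_ge0 //.
    by move=> x _; rewrite -mulrA; apply: mulr_ge0; [rewrite ltW ?w_gt0|exact: sqr_ge0].
  by rewrite Pcheck_n0 !mulr1; exact: (w_gt0 ord0).
exists (fun n => (Num.sqrt (nn n))^-1); split => [n|m n].
  by rewrite invr_gt0 sqrtr_gt0.
have [->|mn] := eqVneq m n; last by rewrite mul0r Pcheck_orth.
by rewrite exprVn invrK mul1r sqr_sqrtr // ltW.
Qed.

Lemma conv_mx_cst y : \sum_x K x y = 1.
Proof.
transitivity (\sum_(x < N.+1) conv_entry q C N l1 l2 l3 x y).
  by apply: eq_bigr => x _; rewrite mxE.
by rewrite conv_cst // -ltnS.
Qed.

Lemma conv_mx_gt0 x y : 0 < K x y.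
Proof. by rewrite mxE conv_gt0 // -ltnS. Qed.

(** For i < j the transpose of [K] sends P_i to degree at most i, and P_j is orthogonal to that. The
    other order follows by self-adjointness, which is [K_rev]. *)
Lemma conv_mx_orth (m n : 'I_N.+1) : m != n ->
  \sum_(y < N.+1) w y * P m y * (\sum_(x < N.+1) K x y * P n x) = 0.
Proof.
have H (i j : 'I_N.+1) : (i < j)%N ->
    \sum_(y < N.+1) w y * P j y * (\sum_(x < N.+1) K x y * P i x) = 0.
  move=> ij; have jN : (j <= N)%N by rewrite -ltnS.
  rewrite -[RHS](Pcheck_orth_deg q01 lam_adm ij jN
    (conv_deg q01 FC l1_adm l2_adm l3_adm (Pcheck_deg q N i lam))).
  by apply: eq_bigr => y _; congr (_ * _); apply: eq_bigr => x _; rewrite mxE.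
rewrite -val_eqE /= neq_ltn => /orP[mn|nm]; last exact: H.
rewrite -[RHS](H _ _ mn).
under eq_bigr => y _ do rewrite mulr_sumr.
rewrite exchange_big /=; apply: eq_bigr => x _; rewrite mulr_sumr.
apply: eq_bigr => y _.
transitivity (K x y * w y * P m y * P n x); first by ring.
by rewrite K_rev; ring.
Qed.

(** Reversibility pulls the weight out of the sum and transposes [K]; the positive weight then
    cancels. *)
Lemma conv_mx_eigen_dual (n x : 'I_N.+1) (k : R) :
  \sum_(y < N.+1) K x y * (w y * P n y) = k * (w x * P n x) <->
  \sum_(y < N.+1) K y x * P n y = k * P n x.
Proof.
have -> : \sum_(y < N.+1) K x y * (w y * P n y) = w x * \sum_(y < N.+1) K y x * P n y.
  by rewrite mulr_sumr; apply: eq_bigr => y _; rewrite mulrA K_rev; ring.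
rewrite (mulrCA k); split=> [/mulfI ->|->] //.
by rewrite gt_eqF // w_gt0.
Qed.

Lemma conv_eigenvalues_exist :
  exists kappa : 'I_N.+1 -> R, conv_eigenvalues q lam K kappa.
Proof.
have [d [d0 dorth]] := norm_consts_exist.
(* The Rayleigh quotient of the transpose of [K] at P_n: its image of P_n has no other component, by
   [conv_mx_orth]. *)
exists (fun n => d n ^+ 2 * \sum_(y < N.+1) w y * P n y * (\sum_(x < N.+1) K x y * P n x)).
move=> n x; apply/conv_mx_eigen_dual.
rewrite (orth_expansion d0 dorth (fun x => \sum_(y < N.+1) K y x * P n y)).
rewrite (bigD1 n) //= [X in _ + X]big1 => [|m mn].
  by rewrite /= addr0 -!mulrA (mulrC (Pcheck _ _ _ _ _)).
by rewrite (conv_mx_orth mn) mulr0.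
Qed.

Variables (d kappa : 'I_N.+1 -> R).
Hypothesis dP : norm_consts q lam d.
Hypothesis kappaP : conv_eigenvalues q lam K kappa.

Lemma norm_const0 : d ord0 = 1.
Proof.
have [d0 dorth] := dP; have := dorth ord0 ord0.
under eq_bigr => x _ do rewrite !Pcheck_0x !mulr1.
rewrite -(big_mkord xpredT (fun x => w x)) op_meas_sum // eqxx mul1r => h.
have : d ord0 ^+ 2 == 1 by rewrite -[_ ^+ 2]invrK -h invr1.
by rewrite sqrf_eq1 => /orP[/eqP //|/eqP h']; have := d0 ord0; rewrite h' ltr0N1.
Qed.

Lemma kappa0 : kappa ord0 = 1.
Proof.
have /conv_mx_eigen_dual := kappaP ord0 ord0.
under eq_bigr => x _ do rewrite Pcheck_0x mulr1.
by rewrite conv_mx_cst Pcheck_0x mulr1.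
Qed.

(** P_n takes both signs: it is 1 at 0, and orthogonality to P_0 = 1 makes its weighted sum vanish.
    The maximum principle [eigenvalue_lt1] then applies. *)
Lemma kappa_lt1 (n : 'I_N.+1) : n != ord0 -> -1 < kappa n < 1.
Proof.
move=> n0.
have s0 : \sum_(x < N.+1) w x * P n x = 0.
  by rewrite -[RHS](Pcheck_orth n0); apply: eq_bigr => x _; rewrite Pcheck_0x mulr1.
have [x1 fx1] : exists x1 : 'I_N.+1, P n x1 < 0.
  apply: contrapT => /forallNP h.
  have wP0 (x : 'I_N.+1) : true -> 0 <= w x * P n x.
    by move=> _; apply: mulr_ge0; [rewrite ltW ?w_gt0|rewrite leNgt; apply/negP].
  have /eqP := psumr_eq0P wP0 s0 (i := ord0) isT.
  by rewrite Pcheck_n0 mulr1 gt_eqF // (w_gt0 ord0).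
apply: (@eigenvalue_lt1 _ _ K _ (fun x => P n x) ord0 x1 conv_mx_gt0 conv_mx_cst) => //.
  by move=> y; apply/conv_mx_eigen_dual; exact: kappaP.
by rewrite Pcheck_n0.
Qed.

End Reversible.

Theorem theorem2p4 (R : realType) (q : R) (q01 : 0 < q < 1)
    (N : nat) (N_ge1 : (1 <= N)%N)
    (F : op_family) (C : convolution) (FC : allowed F C)
    (l1 l2 l3 lam : op_param R F)
    (l1_adm : admissible l1) (l2_adm : admissible l2) (l3_adm : admissible l3)
    (lam_adm : admissible lam)
    (K : 'M[R]_N.+1) (K_conv : K = conv_mx q C N l1 l2 l3)
    (K_rev : forall x y : 'I_N.+1,
       K x y * op_meas q y N lam = K y x * op_meas q x N lam) :
  (exists d : 'I_N.+1 -> R, norm_consts q lam d) /\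
  (exists kappa : 'I_N.+1 -> R, conv_eigenvalues q lam K kappa) /\
  forall d kappa : 'I_N.+1 -> R,
  norm_consts q lam d -> conv_eigenvalues q lam K kappa ->
  [/\ (* (a) *)
      forall P : nat -> 'I_N.+1 -> R, chain_distribution K P ->
      exists c : 'I_N.+1 -> R,
        [/\ (forall x, P 0%N x =
               phihat0 q lam x * \sum_(n < N.+1) c n * phihat q lam d n x)
            /\ (forall c' : 'I_N.+1 -> R,
                 (forall x, P 0%N x =
                    phihat0 q lam x * \sum_(n < N.+1) c' n * phihat q lam d n x) ->
                 forall n, c' n = c n),
            (forall n, c n =
               \sum_(x < N.+1) phihat q lam d n x * (phihat0 q lam x)^-1 * P 0%N x)
            /\ (forall n, c n =
                 d n * \sum_(x < N.+1) Pcheck q N n x lam * P 0%N x),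
            c ord0 = 1,
            forall l x, P l x =
              phihat0 q lam x *
              \sum_(n < N.+1) c n * kappa n ^+ l * phihat q lam d n x
          & forall l x, P l x =
              op_meas q x N lam *
              \sum_(n < N.+1) c n * d n * kappa n ^+ l * Pcheck q N n x lam],
      (* (b) *)
      forall (l : nat) (x y : 'I_N.+1),
        (K ^+ l) x y =
          phihat0 q lam x *
          \sum_(n < N.+1) kappa n ^+ l * phihat q lam d n x * phihat q lam d n y
                          * (phihat0 q lam y)^-1
        /\ (K ^+ l) x y =
          op_meas q x N lam *
          \sum_(n < N.+1) d n ^+ 2 * kappa n ^+ l
                          * Pcheck q N n x lam * Pcheck q N n y lam
    & (* (c) *)
      [/\ kappa ord0 = 1,
          forall n : 'I_N.+1, n != ord0 -> -1 < kappa n < 1,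
          forall P : nat -> 'I_N.+1 -> R, chain_distribution K P ->
            forall x, P l x @[l --> \oo] --> op_meas q x N lam
        & forall x y : 'I_N.+1, (K ^+ l) x y @[l --> \oo] --> op_meas q x N lam]].
Proof.
have K_rev' (x y : 'I_N.+1) : conv_mx q C N l1 l2 l3 x y * op_meas q y N lam =
    conv_mx q C N l1 l2 l3 y x * op_meas q x N lam by rewrite -K_conv K_rev.
split; first exact: norm_consts_exist.
split; first by rewrite K_conv; apply: conv_eigenvalues_exist.
move=> d kappa dP kappaP; have [d0 dorth] := dP.
pose w (x : 'I_N.+1) := op_meas q x N lam.
pose P (n x : 'I_N.+1) := Pcheck q N n x lam.
have w0 x : 0 < w x by exact: w_gt0.
have s2 x : phihat0 q lam x * phihat0 q lam x = w x.
  by rewrite -expr2 sqr_sqrtr //; exact: (ltW (w0 x)).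
have s0 (x : 'I_N.+1) : phihat0 q lam x != 0.
  by rewrite gt_eqF // /phihat0 sqrtr_gt0; exact: (w0 x).
have k0 : kappa ord0 = 1.
  by apply: (@kappa0 _ _ q01 _ _ l1 l2 l3 lam C) => //; rewrite -K_conv.
have k1 n : n != ord0 -> -1 < kappa n < 1.
  by apply: (@kappa_lt1 _ _ q01 _ _ l1 l2 l3 lam C) => //; rewrite -K_conv.
have dn0 : d ord0 = 1 by exact: norm_const0 dP.
have d_neq0 n : d n != 0 by rewrite gt_eqF.
have P0 x : P ord0 x = 1 by exact: Pcheck_0x.
have KlE l x y : (K ^+ l) x y = w x * \sum_n d n ^+ 2 * kappa n ^+ l * P n x * P n y.
  exact: (@expr_spectral _ _ w d P d0 dorth K kappa kappaP).
have chainE p l x : chain_distribution K p ->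
    p l x = w x * \sum_n (d n * \sum_y P n y * p 0%N y) * d n * kappa n ^+ l * P n x.
  by case=> _ _; exact: (@chain_spectral _ _ w d P d0 dorth K kappa kappaP).
have coef0 p : chain_distribution K p -> d ord0 * (\sum_y P ord0 y * p 0%N y) = 1.
  case=> _ p1 _; rewrite dn0 mul1r -[RHS]p1.
  by apply: eq_bigr => y _; rewrite P0 mul1r.
(* Passage between the two forms of the expansions, since [phihat0] squares to the weight. *)
have phisum (a : 'I_N.+1 -> R) x :
    phihat0 q lam x * \sum_n a n * phihat q lam d n x = w x * \sum_n a n * d n * P n x.
  rewrite !mulr_sumr; apply: eq_bigr => n _.
  by rewrite -s2 /phihat /P; ring.
split.
- move=> p pP; exists (fun n => d n * \sum_y P n y * p 0%N y).
  have p0E x : p 0%N x = w x * \sum_n (d n * \sum_y P n y * p 0%N y) * d n * P n x.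
    rewrite {1}(chainE p 0%N x pP); congr (_ * _); apply: eq_bigr => n _.
    by rewrite expr0 mulr1.
  split.
  + split=> [x|c' hc' n]; first by rewrite phisum p0E.
    (* Uniqueness: pairing the expansion with P_n isolates [c' n]. *)
    transitivity (c' n * d n ^+ 2 * \sum_x w x * P n x * P n x); last first.
      under [in RHS]eq_bigr => y _ do rewrite hc' phisum mulr_sumr.
      have h m : \sum_x w x * P n x * P m x = (n == m)%:R / d m ^+ 2 by rewrite dorth.
      transitivity (d n * \sum_m c' m * d m * \sum_x w x * P n x * P m x).
        rewrite [in RHS](bigD1 n) //= [X in _ + X]big1 ?addr0; last first.
          by move=> m mn; rewrite h eq_sym (negPf mn) mul0r mulr0.
        ring.
      congr (_ * _); under eq_bigr => m _ do rewrite mulr_sumr.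
      rewrite exchange_big /=; apply: eq_bigr => y _.
      by rewrite mulr_sumr; apply: eq_bigr => m _; ring.
    by rewrite dorth eqxx mul1r mulfK // expf_neq0.
  + split=> // n; rewrite mulr_sumr; apply: eq_bigr => x _.
    by rewrite /phihat -/(P n x); field.
  + exact: coef0.
  + move=> l x; rewrite phisum (chainE _ _ _ pP); congr (_ * _).
    by apply: eq_bigr => n _; ring.
  + by move=> l x; rewrite (chainE _ _ _ pP).
- move=> l x y; split; last exact: KlE.
  rewrite KlE -s2 -mulrA; congr (_ * _); rewrite mulr_sumr; apply: eq_bigr => n _.
  by rewrite /phihat -/(P n x) -/(P n y); field.
- split=> //.
  + move=> p pP x; have -> : op_meas q x N lam = w x * 1 by rewrite mulr1.
    rewrite (_ : (fun l => p l x) = fun l => w x *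
      \sum_n (d n * \sum_y P n y * p 0%N y) * d n * P n x * kappa n ^+ l); last first.
      apply: funext => l; rewrite (chainE _ _ _ pP); congr (_ * _).
      by apply: eq_bigr => n _; rewrite mulrAC.
    apply: cvgMl_tmp; have := @cvg_spectral_sum R N
      (fun n => (d n * \sum_y P n y * p 0%N y) * d n * P n x) kappa k0 k1.
    (* The surviving coefficient is c_0 d_0 P_0(x) = 1. *)
    by rewrite P0 coef0 // dn0 !mulr1.
  + move=> x y; have -> : op_meas q x N lam = w x * 1 by rewrite mulr1.
    rewrite (_ : (fun l => (K ^+ l) x y) = fun l => w x *
      \sum_n d n ^+ 2 * P n x * P n y * kappa n ^+ l); last first.
      apply: funext => l; rewrite KlE; congr (_ * _).
      by apply: eq_bigr => n _; ring.
    apply: cvgMl_tmp; have := @cvg_spectral_sum R N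
      (fun n => d n ^+ 2 * P n x * P n y) kappa k0 k1.
    by rewrite !P0 dn0 expr1n !mulr1.
Qed.
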